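(* Let $\mathcal{V}$ be a Euclidean Jordan algebra and let $a\in\mathcal{V}$ with $a>0$ (all eigenvalues of $a$ are positive). Then for all $x\in\mathcal{V}$, $$(L_{a^{-1}})^{-1}(x)\prec P_{\sqrt{a}}(x)\prec \int_{0}^{1}P_{a^t,a^{1-t}}(x)\,dt\prec L_a(x),$$ where $P_{u,v}:=L_uL_v+L_vL_u-L_{u\circ v}$ for $u,v\in\mathcal{V}$.
   Context: A Euclidean Jordan algebra $(\mathcal{V},\circ,\langle\cdot,\cdot\rangle)$ is a finite-dimensional real inner product space with a commutative bilinear product $\circ$ satisfying $x\circ(x^2\circ y)=x^2\circ(x\circ y)$ and $\langle x\circ y,z\rangle=\langle y,x\circ z\rangle$, with unit element $e$. A Jordan frame is a set $\{e_1,\ldots,e_n\}$ of primitive idempotents with $e_i\circ e_j=0$ for $i\ne j$ and $\sum_i e_i=e$; all Jordan frames have the same number $n$ of elements, the rank of $\mathcal{V}$. Spectral decomposition: every $x\in\mathcal{V}$ can be written $x=\sum_{i=1}^n x_ie_i$ for some Jordan frame $\{e_1,\ldots,e_n\}$ and real numbers $x_i$, called the eigenvalues of $x$ (uniquely determined with multiplicity). $\lambda(x)\in\mathbb{R}^n$ is the vector of eigenvalues of $x$ in decreasing order, and $\operatorname{tr}(x)$ is the sum of the eigenvalues. The inner product on $\mathcal{V}$ is assumed to be $\langle x,y\rangle=\operatorname{tr}(x\circ y)$. Majorization: for $p,q\in\mathbb{R}^n$, $p\prec q$ means $\sum_{i=1}^k p_i^\downarrow\le\sum_{i=1}^k q_i^\downarrow$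 for all $1\le k\le n$ with equality for $k=n$, where $p^\downarrow$ is the decreasing rearrangement of $p$. For $x,y\in\mathcal{V}$, $x\prec y$ means $\lambda(x)\prec\lambda(y)$. For $a=\sum_i a_ie_i>0$ (spectral decomposition) and real $t$, $a^t:=\sum_i a_i^te_i$; in particular $\sqrt a=a^{1/2}$ and $a^{-1}=\sum_i a_i^{-1}e_i$. The Lyapunov transformation is $L_a(x):=a\circ x$ and the quadratic representation is $P_a(x):=2\,a\circ(a\circ x)-a^2\circ x$. $(L_{a^{-1}})^{-1}$ denotes the inverse of the linear transformation $L_{a^{-1}}$, which is invertible when $a>0$. *)

(* Defs.v *)
From HB Require Import structures.
From mathcomp Require Import all_boot all_order all_algebra.
From mathcomp Require Import all_classical all_reals all_analysis.

Set Implicit Arguments.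
Unset Strict Implicit.
Unset Printing Implicit Defensive.

Import Order.TTheory GRing.Theory Num.Theory.
Import numFieldNormedType.Exports.

Local Open Scope classical_set_scope.
Local Open Scope ring_scope.

Reserved Notation "x ** y" (at level 40, left associativity).
Reserved Notation "x '\prec' y" (at level 70, no associativity).

(* [jdot] is a symmetric, positive definite bilinear form: real inner product. *)
HB.mixin Record isEuclideanJordan (R : realType) V of Vector R V := {
  jmul : {bilinear V -> V -> V};
  jone : V;
  jdot : {dot V for (@idfun R)};
  jmulC : forall x y, jmul x y = jmul y x;
  jmul1x : forall x, jmul jone x = x;
  jordan_identity : forall x y,
    jmul x (jmul (jmul x x) y) = jmul (jmul x x) (jmul x y);
  jdot_assoc : forall x y z, jdot (jmul x y) z = jdot y (jmul x z)
}.

#[short(type="euclideanJordanType")]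
HB.structure Definition EuclideanJordan (R : realType) :=
  { V of Vector R V & isEuclideanJordan R V }.

Notation "x ** y" := (jmul x y) : ring_scope.

Section Spectral.
Context {R : realType} {V : euclideanJordanType R}.
Implicit Types (x y u v a c : V) (s p q : seq R).

Definition idempotent c : Prop := c ** c = c.

Definition primitive_idempotent c : Prop :=
  [/\ idempotent c, c != 0 &
      ~ exists c1 c2, [/\ idempotent c1 /\ idempotent c2,
                          c1 != 0, c2 != 0 & c = c1 + c2]].

Definition jordan_frame n (c : 'I_n -> V) : Prop :=
  [/\ forall i, primitive_idempotent (c i),
      forall i j, i != j -> c i ** c j = 0 &
      \sum_i c i = jone].

Definition spectral_decomposition x n (r : 'I_n -> R) (c : 'I_n -> V) : Prop :=
  jordan_frame c /\ x = \sum_i r i *: c i.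

(* λ(x). The length of this list is the rank of V. By the spectral theorem the
   set below is a singleton, so neither the default value nor the choice made
   by [xget] plays any role. *)
Definition lambda x : seq R :=
  xget [::] [set s | sorted >=%R s /\
    exists c : 'I_(size s) -> V,
      spectral_decomposition x (fun i => s`_i) c].

Definition jtr x : R := \sum_(r <- lambda x) r.

Definition jpos x : Prop := forall r, r \in lambda x -> 0 < r.

(* f(x) = Σ f(x_i) e_i when x = Σ x_i e_i; the value does not depend on the
   chosen decomposition. *)
Definition jfun (f : R -> R) x : V :=
  xget 0 [set y | exists n (r : 'I_n -> R) (c : 'I_n -> V),
    spectral_decomposition x r c /\ y = \sum_i f (r i) *: c i].

(* Meaningful for a > 0, where [powR] is the usual real power. *)
Definition jpow a (t : R) : V := jfun (fun r => r `^ t) a.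
Definition jsqrt a : V := jpow a (2^-1).
Definition jinv a : V := jfun (fun r => r^-1) a.

(* [(lyapunov a)^-1%VF] is a genuine two-sided inverse whenever L_a is bijective,
   which holds for every a > 0. *)
Definition lyapunov a : 'End(V) := linfun (jmul a).

Definition quad_rep a x : V := 2 *: (a ** (a ** x)) - (a ** a) ** x.

Definition quad_rep2 u v : 'End(V) :=
  ((lyapunov u \o lyapunov v)%VF + (lyapunov v \o lyapunov u)%VF
   - lyapunov (u ** v))%R.

Definition decr p : seq R := sort >=%R p.

Definition majorized p q : Prop :=
  [/\ size p = size q,
      forall k, (1 <= k <= size p)%N ->
        \sum_(i < k) (decr p)`_i <= \sum_(i < k) (decr q)`_i &
      \sum_(i < size p) (decr p)`_i = \sum_(i < size q) (decr q)`_i].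

Definition jmajorized x y : Prop := majorized (lambda x) (lambda y).

(* ∫_0^1 f(t) dt for V-valued f, computed coordinatewise in a basis of V;
   by linearity of the integral the result does not depend on the basis as soon
   as the coordinates of f are integrable (e.g. f continuous). *)
Definition vintegral01 (f : R -> V) : V :=
  \sum_(i < \dim {:V})
    (\int[lebesgue_measure]_(t in `[0%R, 1%R]) coord (vbasis {:V}) i (f t))%R
      *: (vbasis {:V})`_i.

End Spectral.

Notation "x \prec y" := (jmajorized x y) : ring_scope.

(* Main.v *)
Require Import Defs.
From HB Require Import structures.
From mathcomp Require Import all_boot all_order all_algebra.
From mathcomp Require Import all_classical all_reals all_analysis.
From mathcomp Require Import complex.
From mathcomp Require Import ring lra zify.

(* Let [a = sum_i a_i c_i] and write [x = sum_ij x_ij] for the Peirce decomposition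
   of [x] along the frame [c]. With [a_i = exp (2 s_i)], the four vectors of the
   theorem are Schur multiples of [x]: the entry [x_ij] is multiplied by the
   harmonic, geometric, logarithmic and arithmetic mean of [a_i] and [a_j], i.e. by
   [exp (s_i + s_j)] times [1 / cosh v], [1], [sinh v / v] and [cosh v] respectively,
   where [v = s_i - s_j]. So each vector is obtained from the next one by the Schur
   multiplier [1 / cosh v], [v / sinh v], [tanh v / v].

   A symmetric Schur multiplier with unit diagonal which preserves the cone of
   nonnegative elements is a doubly stochastic map, hence decreases its argument for
   majorization. Positivity of the three multipliers all comes from the elementary
   fact that [L_u^-1] preserves the cone when [u > 0], because positive multipliers
   are stable under products, sums and limits: [exp (s_i + s_j)] is the limit of
   [(1 - (s_i + s_j) / N)^-N], which gives [1 / cosh v], and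
     [v / sinh v = prod_(k >= 1) 1 / cosh (v / 2^k)],
     [tanh v / v = prod_(k >= 0) (1 + 1 / cosh (v / 2^k)) / 2].

   The hypothesis on the inner product gives [<c, c> = 1] for every primitive
   idempotent [c], so that all frames have [<e, e>] elements. *)

Set Implicit Arguments.
Unset Strict Implicit.
Unset Printing Implicit Defensive.

Import Order.TTheory GRing.Theory Num.Theory.
Import numFieldNormedType.Exports.

Local Open Scope classical_set_scope.
Local Open Scope ring_scope.

(** * Consequences of the Jordan identity *)

Section LinearizedIdentities.
Context {R : realType} {V : euclideanJordanType R}.
Implicit Types (x y z u w a b c : V).

(* Copies of [jmul] and [jdot] whose values have syntactically the types [V] and
   [R], so that sums of such values are sums in [V] and [R]. *)
Definition jprod x y : V := jmul x y.
Definition dotp x y : R := jdot x y.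

Local Notation "x *o y" := (jprod x y) (at level 40, left associativity).

Lemma jprodDl x y z : (x + y) *o z = x *o z + y *o z.
Proof. exact: linearDl. Qed.

Lemma jprodDr x y z : x *o (y + z) = x *o y + x *o z.
Proof. exact: linearDr. Qed.

Lemma jprodBl x y z : (x - y) *o z = x *o z - y *o z.
Proof. exact: linearBl. Qed.

Lemma jprodBr x y z : x *o (y - z) = x *o y - x *o z.
Proof. exact: linearBr. Qed.

Lemma jprodNl x y : (- x) *o y = - (x *o y).
Proof. exact: linearNl. Qed.

Lemma jprodNr x y : x *o (- y) = - (x *o y).
Proof. exact: linearNr. Qed.

Lemma jprodZl k x y : (k *: x) *o y = k *: (x *o y).
Proof. exact: linearZl_LR. Qed.

Lemma jprodZr k x y : x *o (k *: y) = k *: (x *o y).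
Proof. exact: linearZr_LR. Qed.

Lemma jprod0x x : 0 *o x = 0.
Proof. exact: linear0l. Qed.

Lemma jprodx0 x : x *o 0 = 0.
Proof. exact: linear0r. Qed.

Lemma jprodx1 x : x *o jone = x.
Proof. by rewrite /jprod jmulC jmul1x. Qed.

Lemma jprod_suml I (s : seq I) (P : pred I) (F : I -> V) x :
  (\sum_(i <- s | P i) F i) *o x = \sum_(i <- s | P i) F i *o x.
Proof. exact: linear_sumlz. Qed.

Lemma jprod_sumr I (s : seq I) (P : pred I) (F : I -> V) x :
  x *o (\sum_(i <- s | P i) F i) = \sum_(i <- s | P i) x *o F i.
Proof. exact: linear_sumr. Qed.

Lemma dotpC x y : dotp x y = dotp y x.
Proof. by have := hermC (@jdot R V) x y; rewrite expr0 mul1r. Qed.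

Lemma dotpDl x y z : dotp (x + y) z = dotp x z + dotp y z.
Proof. exact: linearDl. Qed.

Lemma dotpDr x y z : dotp x (y + z) = dotp x y + dotp x z.
Proof. exact: linearDr. Qed.

Lemma dotpBl x y z : dotp (x - y) z = dotp x z - dotp y z.
Proof. exact: linearBl. Qed.

Lemma dotpNl x y : dotp (- x) y = - dotp x y.
Proof. exact: linearNl. Qed.

Lemma dotpNr x y : dotp x (- y) = - dotp x y.
Proof. exact: linearNr. Qed.

Lemma dotpZl k x y : dotp (k *: x) y = k * dotp x y.
Proof. exact: linearZl_LR. Qed.

Lemma dotpZr k x y : dotp x (k *: y) = k * dotp x y.
Proof. exact: linearZr_LR. Qed.

Lemma dotp0l x : dotp 0 x = 0.
Proof. exact: linear0l. Qed.

Lemma dotp0r x : dotp x 0 = 0.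
Proof. exact: linear0r. Qed.

Lemma dotp_suml I (s : seq I) (P : pred I) (F : I -> V) x :
  dotp (\sum_(i <- s | P i) F i) x = \sum_(i <- s | P i) dotp (F i) x.
Proof. exact: linear_sumlz. Qed.

Lemma dotp_sumr I (s : seq I) (P : pred I) (F : I -> V) x :
  dotp x (\sum_(i <- s | P i) F i) = \sum_(i <- s | P i) dotp x (F i).
Proof. exact: linear_sumr. Qed.

Lemma dotp_gt0 x : x != 0 -> 0 < dotp x x.
Proof. exact: neq0_dnorm_gt0. Qed.

Lemma dotp_ge0 x : 0 <= dotp x x.
Proof. by have [->|/dotp_gt0/ltW//] := eqVneq x 0; rewrite dotp0l. Qed.

Lemma dotp_eq0 x : dotp x x = 0 -> x = 0.
Proof.
by move=> x0; apply: contra_eq x0 => /dotp_gt0; rewrite lt0r => /andP[].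
Qed.

Lemma dotp_inj x y : (forall t, dotp x t = dotp y t) -> x = y.
Proof.
move=> xy; apply/eqP; rewrite -subr_eq0; apply/eqP/dotp_eq0.
by rewrite dotpBl xy subrr.
Qed.

Lemma jprodC x y : x *o y = y *o x.
Proof. exact: jmulC. Qed.

Lemma jprod1x x : jone *o x = x.
Proof. exact: jmul1x. Qed.

Lemma jprod_jordan x y : x *o (x *o x *o y) = x *o x *o (x *o y).
Proof. exact: jordan_identity. Qed.

Lemma jprod_selfadj x y z : dotp (x *o y) z = dotp y (x *o z).
Proof. exact: (@jdot_assoc R V). Qed.

(* Equations between vectors are checked after pairing with an arbitrary
   vector, which turns them into linear equations between reals. *)
Definition dotpE := (jprodDl, jprodDr, jprodNl, jprodNr, jprodZl, jprodZr,
  dotpDl, dotpDr, dotpNl, dotpNr, dotpZl, dotpZr).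

(** Inclusion-exclusion on the values of [F] at [x + y + z], at the sums of two vectors and at
    single vectors leaves exactly the mixed terms. *)
Lemma polarize3 (F : V -> V -> V -> R) :
  (forall a b y z, F (a + b) y z = F a y z + F b y z) ->
  (forall x a b z, F x (a + b) z = F x a z + F x b z) ->
  (forall x y a b, F x y (a + b) = F x y a + F x y b) ->
  (forall x, F x x x = 0) -> forall x y z,
  F x y z + F x z y + F y x z + F y z x + F z x y + F z y x = 0.
Proof.
move=> F1 F2 F3 F0 x y z.
have := F0 (x + y + z); have := F0 (x + y); have := F0 (x + z).
have := F0 (y + z); have := F0 x; have := F0 y; have := F0 z.
rewrite !(F1, F2, F3); lra.
Qed.

(** Full polarization of the Jordan identity in its repeated variable; [F] is symmetric in its last
    two arguments, so six mixed terms collapse to three. *)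
Lemma jordan_linearized x y z w :
  x *o (y *o z *o w) + y *o (z *o x *o w) + z *o (x *o y *o w) =
  y *o z *o (x *o w) + z *o x *o (y *o w) + x *o y *o (z *o w).
Proof.
apply: dotp_inj => t.
pose F a b c := dotp (a *o (b *o c *o w)) t - dotp (b *o c *o (a *o w)) t.
have F1 a b c d : F (a + b) c d = F a c d + F b c d.
  by rewrite /F !(jprodDl, jprodDr, dotpDl); ring.
have F2 a b c d : F a (b + c) d = F a b d + F a c d.
  by rewrite /F !(jprodDl, jprodDr, dotpDl); ring.
have Fsym a b c : F a b c = F a c b by rewrite /F (jprodC b c).
have F3 a b c d : F a b (c + d) = F a b c + F a b d.
  by rewrite Fsym F2 !(Fsym _ b).
have F0 a : F a a a = 0 by rewrite /F jprod_jordan subrr.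
have := polarize3 F1 F2 F3 F0 x y z.
rewrite (Fsym x z y) (Fsym y z x) (Fsym z x y) (Fsym y x z) /F => e.
rewrite !dotpDl (jprodC y x) in e *.
move: e; lra.
Qed.

(** The linearized identity read as an identity between operators acting on [y], solved for
    multiplication by [(z *o x) *o w]. *)
Lemma jprod_triple x z w y :
  (z *o x) *o w *o y =
  x *o w *o (z *o y) + z *o x *o (w *o y) + z *o w *o (x *o y)
  - x *o (w *o (z *o y)) - z *o (w *o (x *o y)).
Proof.
apply: dotp_inj => t.
have := congr1 (fun u => dotp u t) (jordan_linearized x y z w).
rewrite /= !dotpE (jprodC y (z *o x *o w)) (jprodC (y *o z) w) (jprodC y z).
rewrite (jprodC (x *o y) w) (jprodC (z *o y) (x *o w)) (jprodC y w).
rewrite (jprodC (x *o y) (z *o w)).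
lra.
Qed.

(** Multiplication by an idempotent is a root of [t (2 t - 1) (t - 1)], so its possible eigenvalues
    are 0, 1/2 and 1. *)
Lemma idem_cubic c y : c *o c = c ->
  c *o y = 3 *: (c *o (c *o y)) - 2 *: (c *o (c *o (c *o y))).
Proof.
move=> cc; have := jprod_triple c c c y; rewrite !cc => {1}->.
by apply: dotp_inj => t; rewrite !dotpE; lra.
Qed.

Lemma orth_idem_comm a b y : b *o b = b -> a *o b = 0 ->
  a *o (b *o y) = b *o (a *o y).
Proof.
move=> bb ab; have := jordan_linearized a b b y.
rewrite [b *o a]jprodC ab !bb !jprod0x !jprodx0 !addr0.
by [].
Qed.

(** On the image of multiplication by [b], multiplication by [a] is a root of [t (2 t - 1)]:
    orthogonality excludes the eigenvalue 1. *)
Lemma orth_idem_sq a b y : a *o a = a -> b *o b = b -> a *o b = 0 ->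
  a *o (b *o y) = 2 *: (a *o (a *o (b *o y))).
Proof.
move=> aa bb ab; have := jprod_triple a a b y; rewrite aa ab !jprod0x.
rewrite -(orth_idem_comm y bb ab) => e; apply: dotp_inj => t.
move/(congr1 (fun u => dotp u t)): e.
by rewrite !(dotpE, dotp0l); lra.
Qed.

Lemma orth_idem_triple a b c y : a *o a = a -> b *o b = b -> c *o c = c ->
  a *o b = 0 -> b *o c = 0 -> a *o c = 0 -> a *o (b *o (c *o y)) = 0.
Proof.
move=> aa bb cc ab bc ac; have := jprod_triple a c b y.
rewrite [c *o a]jprodC [c *o b]jprodC ac ab bc !jprod0x.
rewrite -(orth_idem_comm y bb ab) (orth_idem_comm y cc bc).
rewrite (orth_idem_comm _ cc ac) => e; apply: dotp_inj => t.
by move/(congr1 (fun u => dotp u t)): e; rewrite !(dotpE, dotp0l); lra.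
Qed.

(** The eigenvalues 0, 1/2 and 1 all satisfy [t^2 <= t <= 2 t^2]; the cubic relation stands in for a
    diagonalization. *)
Lemma idem_form_bounds c x : c *o c = c ->
  dotp (c *o x) (c *o x) <= dotp (c *o x) x /\
  dotp (c *o x) x <= 2 * dotp (c *o x) (c *o x).
Proof.
move=> cc; set v := c *o x; set w := c *o v.
have wv : dotp w x = dotp v v by rewrite jprod_selfadj.
have cw : c *o w = (3 / 2) *: w - (1 / 2) *: v.
  have e := idem_cubic x cc; apply: dotp_inj => t.
  by move/(congr1 (fun u => dotp u t)): e; rewrite -/v -/w !dotpE; lra.
have ww : dotp w v = (3 * dotp v v - dotp v x) / 2.
  have -> : dotp w v = dotp (c *o w) x by rewrite jprod_selfadj.
  by rewrite cw !dotpE wv; lra.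
have www : dotp w w = (3 * dotp w v - dotp v v) / 2.
  have -> : dotp w w = dotp (c *o w) v by rewrite jprod_selfadj.
  by rewrite cw !dotpE; lra.
(* By the moment relations above, these squares equal [2 |v|^2 - <v, x>] and
   [(<v, x> - |v|^2) / 4]. *)
have := dotp_ge0 (2 *: w - v); have := dotp_ge0 (v - w).
by rewrite !dotpE (dotpC v w) www ww; lra.
Qed.

(** [<c, d> = <c d, d>], which dominates [|c d|^2]. *)
Lemma idem_dot_ge0 c d : c *o c = c -> d *o d = d -> 0 <= dotp c d.
Proof.
move=> cc dd; have [h1 h2] := idem_form_bounds d cc.
have := dotp_ge0 (c *o d).
have -> : dotp c d = dotp (c *o d) d by rewrite jprodC jprod_selfadj dd.
lra.
Qed.

Lemma idem_dot_eq0 c d : c *o c = c -> d *o d = d -> dotp c d = 0 ->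
  c *o d = 0.
Proof.
move=> cc dd cd; have [h1 h2] := idem_form_bounds d cc.
apply: dotp_eq0; apply/eqP; rewrite eq_le dotp_ge0 andbT.
by apply: le_trans h1 _; rewrite [c *o d]jprodC jprod_selfadj dd cd.
Qed.

End LinearizedIdentities.

Local Notation "x *o y" := (jprod x y) (at level 40, left associativity).

(** * Polynomials in one element *)

Section PowerAssociativity.
Context {R : realType} {V : euclideanJordanType R}.
Implicit Types (x y z u w a b c : V).

Definition jpown x n : V := iter n (jprod x) jone.

Lemma jpownS x n : jpown x n.+1 = x *o jpown x n.
Proof. by []. Qed.

Lemma jpown_rec x n y : jpown x n.+2 *o y =
  x *o x *o (jpown x n *o y) + jpown x n.+1 *o (x *o y)
  + jpown x n.+1 *o (x *o y)
  - x *o (x *o (jpown x n *o y)) - jpown x n *o (x *o (x *o y)).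
Proof.
have := jprod_triple x (jpown x n) x y.
by rewrite [jpown x n *o x]jprodC -jpownS [jpown x n.+1 *o x]jprodC -jpownS.
Qed.

(** Multiplications by [x] and by [x *o x] commute by the Jordan identity, and [jpown_rec] builds
    multiplication by every power from these two. *)
Lemma jpown_comm x n y :
  x *o (jpown x n *o y) = jpown x n *o (x *o y) /\
  x *o x *o (jpown x n *o y) = jpown x n *o (x *o x *o y).
Proof.
have AB u : x *o (x *o x *o u) = x *o x *o (x *o u) by apply: jprod_jordan.
(* The recursion has order two, so the induction carries two consecutive exponents. *)
suff : (forall y, x *o (jpown x n *o y) = jpown x n *o (x *o y) /\
         x *o x *o (jpown x n *o y) = jpown x n *o (x *o x *o y)) /\
       (forall y, x *o (jpown x n.+1 *o y) = jpown x n.+1 *o (x *o y) /\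
         x *o x *o (jpown x n.+1 *o y) = jpown x n.+1 *o (x *o x *o y)).
  by case.
elim: n {y} => [|n [IH IH1]].
  split=> y; first by rewrite /jpown /= !jprod1x.
  by rewrite /jpown /= !jprodx1 AB.
split=> // y; rewrite !jpown_rec.
move: (jpown x n) (jpown x n.+1) IH IH1 => p q Hp Hq.
have pA u : x *o (p *o u) = p *o (x *o u) by have [] := Hp u.
have pB u : x *o x *o (p *o u) = p *o (x *o x *o u) by have [] := Hp u.
have qA u : x *o (q *o u) = q *o (x *o u) by have [] := Hq u.
have qB u : x *o x *o (q *o u) = q *o (x *o x *o u) by have [] := Hq u.
rewrite !(jprodDr, jprodNr).
by split; rewrite !(pA, pB, qA, qB, AB).
Qed.

(** * Evaluation of polynomials at an element *)

Definition peval x (p : {poly R}) : V := \sum_(i < size p) p`_i *: jpown x i.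

Lemma peval_wide x (p : {poly R}) n : (size p <= n)%N ->
  peval x p = \sum_(i < n) p`_i *: jpown x i.
Proof.
move=> pn; rewrite /peval (big_ord_widen _ (fun i => p`_i *: jpown x i) pn).
rewrite [RHS](bigID (fun i : 'I_n => (i < size p)%N)) /= [X in _ + X]big1 ?addr0 //.
by move=> i; rewrite -leqNgt => /(nth_default 0) ->; rewrite scale0r.
Qed.

Lemma pevalD x (p q : {poly R}) : peval x (p + q) = peval x p + peval x q.
Proof.
pose n := maxn (size p) (size q).
rewrite (@peval_wide x (p + q) n) ?size_polyD//.
rewrite (@peval_wide x p n) ?leq_maxl// (@peval_wide x q n) ?leq_maxr//.
by rewrite -big_split; apply: eq_bigr => i _; rewrite coefD scalerDl.
Qed.

Lemma pevalC x k : peval x k%:P = k *: jone.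
Proof.
by rewrite (@peval_wide x _ 1) ?size_polyC_leq1// big_ord1 coefC eqxx.
Qed.

Lemma pevalMX x (p : {poly R}) : peval x (p * 'X) = x *o peval x p.
Proof.
rewrite (@peval_wide x _ (size p).+1); last first.
  by rewrite (leq_trans (size_polyMleq _ _))// size_polyX addn2.
rewrite big_ord_recl coefMX scale0r add0r /peval jprod_sumr.
by apply: eq_bigr => i _; rewrite coefMX lift0 jpownS jprodZr.
Qed.

Lemma pevalZ x k (p : {poly R}) : peval x (k *: p) = k *: peval x p.
Proof.
rewrite (@peval_wide x (k *: p) (size p)) ?size_scale_leq// /peval scaler_sumr.
by apply: eq_bigr => i _; rewrite coefZ scalerA.
Qed.

Lemma peval_comm x (p : {poly R}) y :
  x *o (peval x p *o y) = peval x p *o (x *o y).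
Proof.
rewrite /peval !jprod_suml jprod_sumr; apply: eq_bigr => i _.
by rewrite !jprodZl jprodZr (proj1 (jpown_comm x i y)).
Qed.

(** Power associativity: induction on [p] in Horner form, where [peval_comm] moves the factor [x]
    past [peval x q]. *)
Lemma pevalM x (p q : {poly R}) : peval x (p * q) = peval x p *o peval x q.
Proof.
elim/poly_ind: p => [|p k IH]; first by rewrite mul0r /peval size_poly0 big_ord0 jprod0x.
rewrite mulrDl -mulrA ['X * q]mulrC mulrA mul_polyC !pevalD !pevalMX pevalZ IH.
rewrite pevalC jprodDl jprodZl jprod1x; congr (_ + _).
by rewrite [in RHS]jprodC -peval_comm [peval x q *o _]jprodC.
Qed.

Lemma peval0 x : peval x 0 = 0.
Proof. by rewrite /peval size_poly0 big_ord0. Qed.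

Lemma peval1 x : peval x 1 = jone.
Proof. by rewrite -[1]/(1%:P) pevalC scale1r. Qed.

Lemma pevalX x : peval x 'X = x.
Proof. by rewrite -[X in peval x X]mul1r pevalMX peval1 jprodx1. Qed.

Lemma peval_sum x I (s : seq I) (F : I -> {poly R}) :
  peval x (\sum_(i <- s) F i) = \sum_(i <- s) peval x (F i).
Proof. by apply: (big_morph (peval x)) => [p q|]; rewrite ?pevalD ?peval0. Qed.

(** [|p(x)|^2 = <e, p(x)^2>]. *)
Lemma peval_sq_eq0 x (p : {poly R}) : peval x (p * p) = 0 -> peval x p = 0.
Proof.
rewrite pevalM => pp; apply: dotp_eq0.
by rewrite -{1}[peval x p]jprodx1 jprod_selfadj pp dotp0r.
Qed.

(* Writing [w = h(x)], one gets
   [0 = <(x - s)^2 w + t^2 w, w> = |(x - s) w|^2 + t^2 |w|^2]. *)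
Lemma peval_quad_eq0 x (h : {poly R}) (s t : R) : t != 0 ->
  peval x ((('X - s%:P) ^+ 2 + (t ^+ 2)%:P) * h) = 0 -> peval x h = 0.
Proof.
move=> t0; rewrite expr2 mulrDl -mulrA pevalD mul_polyC pevalZ.
rewrite pevalM [in X in _ *o X]pevalM.
set w := peval x h; set y := peval x _ => e.
have : dotp (y *o (y *o w) + t ^+ 2 *: w) w = 0 by rewrite e dotp0l.
rewrite dotpDl jprod_selfadj dotpZl => e2; apply: dotp_eq0.
have := dotp_ge0 (y *o w); have := dotp_ge0 w => w0 yw0.
have /eqP : t ^+ 2 * dotp w w = 0.
  by apply/eqP; rewrite eq_le mulr_ge0 ?sqr_ge0// andbT -e2 lerDr.
by rewrite mulf_eq0 sqrf_eq0 (negPf t0) => /eqP.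
Qed.

End PowerAssociativity.

(** * The spectral theorem *)

Section SpectralTheorem.
Context {R : realType} {V : euclideanJordanType R}.
Implicit Types (x y z u w a b c : V).

(** A complex root [s + i t] supplies the factor. When [t != 0], the remainder modulo the quadratic
    is a real polynomial of degree at most one vanishing at a nonreal point, hence zero. *)
Lemma real_poly_factor (p : {poly R}) : (1 < size p)%N ->
  (exists s h, p = ('X - s%:P) * h) \/
  (exists s t h, t != 0 /\ p = (('X - s%:P) ^+ 2 + (t ^+ 2)%:P) * h).
Proof.
move=> p1; pose f : {rmorphism R -> complex R} := real_complex R.
have /closed_rootP[[s t] rz] : size (map_poly f p) != 1%N.
  by rewrite size_map_poly; case: (size p) p1 => [|[]].
have [t0|t0] := eqVneq t 0.
  left; move: rz; rewrite t0 -[(_ +i* _)%C]/(f s) fmorph_root => /factor_theorem[h ->].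
  by exists s, h; rewrite mulrC.
right; exists s, t; set q := _ + _.
pose z := (s +i* t)%C; rewrite -/z in rz.
have qz : (map_poly f q).[z] = 0.
  rewrite /q rmorphD rmorphXn rmorphB /= map_polyX !map_polyC /= !hornerE.
  by apply/eqP; rewrite eq_complex /=; apply/andP; split; apply/eqP; rewrite /=; ring.
have sq : size q = 3%N.
  rewrite /q size_polyDl ?size_exp_XsubC// (leq_ltn_trans (size_polyC_leq1 _))//.
have q0 : q != 0 by rewrite -size_poly_eq0 sq.
have : (size (p %% q)%R <= 2)%N by rewrite -ltnS -sq ltn_modp.
set r := p %% q => sr.
have rz0 : (map_poly f r).[z] = 0.
  move: rz; rewrite {1}(divp_eq p q) rmorphD rmorphM /= /root !hornerE qz mulr0 add0r.
  by move/eqP.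
have rE : r = (r`_1)%:P * 'X + (r`_0)%:P.
  apply/polyP => i; rewrite coefD coefMX !coefC.
  case: i => [|[|i]] /=; rewrite ?add0r ?addr0 ?coefC //.
  by rewrite nth_default// (leq_trans sr).
have r0 : r = 0.
  move: rz0; rewrite rE rmorphD rmorphM /= map_polyX !map_polyC /= !hornerE.
  move/eqP; rewrite eq_complex /= !mul0r !subr0 !addr0 => /andP[/eqP e1 /eqP e2].
  have r10 : r`_1 = 0 by move/eqP: e2; rewrite mulf_eq0 (negPf t0) orbF => /eqP.
  by move: e1; rewrite r10 mul0r add0r => ->; rewrite !polyC0 mul0r addr0.
exists (p %/ q); split=> //.
by rewrite {1}(divp_eq p q) -/r r0 addr0 mulrC.
Qed.

Lemma exists_annihilator x : exists2 p : {poly R}, p != 0 & peval x p = 0.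
Proof.
pose n := \dim {:V}; pose X := [tuple jpown x i | i < n.+1].
have nf : ~~ free X.
  apply/negP => /eqnP f; have := dimvS (subvf <<X>>%VS).
  by rewrite f size_tuple ltnn.
apply: contrapT => H; move/negP: nf; apply; apply/freeP => k ks i.
apply: contrapT => /eqP ki; apply: H.
have kE j : (\poly_(j < n.+1) k (inord j))`_(val j) = k j.
  by rewrite coef_poly ltn_ord inord_val.
exists (\poly_(j < n.+1) k (inord j)).
  by apply: contra_neq ki => e; rewrite -kE e coef0.
rewrite (peval_wide _ (size_poly _ _)) -[RHS]ks; apply: eq_bigr => j _.
by rewrite kE -tnth_nth tnth_mktuple.
Qed.

(** Quadratic factors and multiplicities can be cancelled from an annihilating polynomial, by
    [peval_quad_eq0] and [peval_sq_eq0]. *)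
Lemma annihilator_split x : exists2 s : seq R,
  uniq s & peval x (\prod_(r <- s) ('X - r%:P)) = 0.
Proof.
(* The cofactor [h] holds the linear factors already split off from [p]. *)
suff H n (p h : {poly R}) : (size p <= n)%N -> p != 0 -> peval x (p * h) = 0 ->
    exists2 s : seq R, uniq s & peval x ((\prod_(r <- s) ('X - r%:P)) * h) = 0.
  have [p p0 px] := exists_annihilator x.
  have [|s us e] := H (size p) p 1 (leqnn _) p0; first by rewrite mulr1.
  by exists s; rewrite // -[X in peval x X]mulr1.
elim: n p h => [|n IH] p h; first by rewrite leqn0 size_poly_eq0 => ->.
move=> pn p0 ph; have [p1|p1] := leqP (size p) 1.
  exists [::] => //; rewrite big_nil mul1r.
  move: p0 ph; rewrite (size1_polyC p1) polyC_eq0 mul_polyC pevalZ => c0 /eqP.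
  by rewrite scaler_eq0 (negPf c0) => /eqP.
have [[s [g pE]]|[s [t [g [t0 pE]]]]] := real_poly_factor p1.
- have g0 : g != 0 by apply: contra_neq p0 => g0; rewrite pE g0 mulr0.
  have gn : (size g <= n)%N.
    by move: pn; rewrite pE mulrC size_Mmonic ?monicXsubC// size_XsubC addn2.
  have [|l ul le] := IH g (('X - s%:P) * h) gn g0.
    by rewrite mulrA [g * _]mulrC -pE.
  have [sl|sl] := boolP (s \in l); last first.
    exists (s :: l); first by rewrite /= sl.
    by rewrite big_cons [('X - _) * _]mulrC -mulrA.
  exists l => //; apply: peval_sq_eq0.
  move: le; rewrite (big_rem s)//=; set G := \prod_(_ <- _) _ => le.
  (* The root [s] is repeated: the square of the polynomial with a single factor ['X - s] is a
     multiple of the known annihilator. *)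
  have -> : ('X - s%:P) * G * h * (('X - s%:P) * G * h) =
      ('X - s%:P) * G * (('X - s%:P) * h) * (G * h) by ring.
  by rewrite pevalM le jprod0x.
- have g0 : g != 0 by apply: contra_neq p0 => g0; rewrite pE g0 mulr0.
  apply: (IH g) => //; last by apply: (@peval_quad_eq0 _ _ x _ s t) => //; rewrite mulrA -pE.
  have sq : size (('X - s%:P) ^+ 2 + (t ^+ 2)%:P) = 3%N.
    rewrite size_polyDl ?size_exp_XsubC// (leq_ltn_trans (size_polyC_leq1 _))//.
  have q0 : ('X - s%:P) ^+ 2 + (t ^+ 2)%:P != 0 by rewrite -size_poly_eq0 sq.
  by move: pn; rewrite pE size_mul// sq addSn /= !addSn add0n ltnS => /ltnW.
Qed.

Lemma lagrange_basis_poly (s : seq R) t :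
  exists p : {poly R}, {in s, forall r, p.[r] = (r == t)%:R}.
Proof.
pose q := \prod_(r <- s | r != t) ('X - r%:P).
have qt : q.[t] != 0.
  rewrite horner_prod prodf_seq_neq0; apply/allP => r _; apply/implyP => rt.
  by rewrite !hornerE subr_eq0 eq_sym.
exists (q.[t]^-1 *: q) => r rs; rewrite hornerZ.
have [->|rt] := eqVneq r t; first by rewrite mulVf.
rewrite [q.[r]](_ : _ = 0) ?mulr0//; apply/eqP.
by rewrite horner_prod prodf_seq_eq0; apply/hasP; exists r; rewrite ?rt ?hornerE ?subrr.
Qed.

Lemma interpolation (s : seq R) (f : R -> R) :
  exists p : {poly R}, {in s, forall r, p.[r] = f r}.
Proof.
have /choice[ell ellP] := lagrange_basis_poly s.
exists (\sum_(t <- undup s) f t *: ell t) => r rs.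
rewrite horner_sum (bigD1_seq r) ?undup_uniq ?mem_undup//= hornerZ ellP// eqxx mulr1.
rewrite big1 ?addr0// => t tr; rewrite hornerZ ellP// eq_sym (negPf tr) mulr0 //.
Qed.

(** The idempotents need not be primitive; the list form lets one entry be replaced by two. *)
Definition idem_resolution x (t : seq (R * V)) : Prop :=
  [/\ {in t, forall p, p.2 *o p.2 = p.2 /\ p.2 != 0},
      pairwise (fun p q => p.2 *o q.2 == 0) t,
      \sum_(p <- t) p.2 = jone &
      \sum_(p <- t) p.1 *: p.2 = x].

(** The idempotents are the values at [x] of the Lagrange polynomials of the roots of a split
    annihilator; those that vanish are dropped. *)
Lemma exists_idem_resolution x : exists t, idem_resolution x t.
Proof.
have [s us sx] := annihilator_split x.
(* Polynomials that agree on the roots differ by a multiple of the annihilator. *)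
have eqx (p q : {poly R}) : {in s, forall r, p.[r] = q.[r]} -> peval x p = peval x q.
  move=> pq; have : \prod_(r <- s) ('X - r%:P) %| p - q.
    apply: uniq_roots_dvdp; last by rewrite uniq_rootsE.
    by apply/allP => r rs; rewrite /root !hornerE pq// subrr.
  move=> /dvdpP[u e]; rewrite -[p](subrK q) pevalD e pevalM sx jprodx0 add0r //.
have /choice[ell ellP] := lagrange_basis_poly s.
pose e r := peval x (ell r).
pose nz r := e r != 0.
have ee r t : r \in s -> e r *o e t = if r == t then e r else 0.
  move=> rs; rewrite /e -pevalM -(peval0 x) -[in RHS]fun_if; apply: eqx => i si.
  rewrite hornerM !ellP//; have [->|irt] := eqVneq r t.
    by rewrite ellP//; case: eqP; rewrite ?mulr1 ?mulr0.
  rewrite horner0; have [->|_] := eqVneq i r; last by rewrite mul0r.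
  by rewrite (negPf irt) mulr0.
have sum_nz (F : R -> V) : (forall r, e r = 0 -> F r = 0) ->
    \sum_(r <- s | nz r) F r = \sum_(r <- s) F r.
  move=> F0; rewrite [RHS](bigID nz) /= [X in _ + X]big1 ?addr0//.
  by move=> r; rewrite negbK => /eqP; exact: F0.
exists [seq (r, e r) | r <- s & nz r]; split.
- move=> p /mapP[r]; rewrite mem_filter => /andP[r0 rs] -> /=.
  by rewrite ee// eqxx.
- rewrite pairwise_map; apply: pairwise_filter.
  move: us; rewrite uniq_pairwise; apply: (@sub_in_pairwise _ (mem s)) => [r t rs ts /= rt|];
    last exact/allP.
  by rewrite ee// (negPf rt).
- rewrite big_map big_filter sum_nz// /e -peval_sum -(peval1 x); apply: eqx => r rs.
  rewrite horner_sum hornerC (bigD1_seq r)//= ellP// eqxx big1 ?addr0// => t tr.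
  by rewrite ellP// eq_sym (negPf tr).
- rewrite big_map big_filter sum_nz => [|r -> /=]; last by rewrite scaler0.
  rewrite /e -[RHS]pevalX.
  under eq_bigr do rewrite /= -pevalZ.
  rewrite -peval_sum; apply: eqx => r rs.
  rewrite horner_sum hornerX (bigD1_seq r)//= hornerZ ellP// eqxx mulr1 big1 ?addr0// => t tr.
  by rewrite hornerZ ellP// eq_sym (negPf tr) mulr0.
Qed.

(** Nonzero orthogonal idempotents are linearly independent: multiplying a relation by one of them
    isolates its coefficient. *)
Lemma idem_resolution_size x t : idem_resolution x t -> (size t <= \dim {:V})%N.
Proof.
move=> [t1 t2 _ _]; pose X := [tuple (nth (0, 0) t i).2 | i < size t].
suff /eqnP f : free X.
  by have := dimvS (subvf <<X>>%VS); rewrite f size_tuple.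
have XE (i : 'I_(size t)) : X`_i = (nth (0, 0) t i).2.
  by rewrite -tnth_nth tnth_mktuple.
apply/freeP => k ks i.
have [ii i0] := t1 _ (mem_nth (0, 0) (ltn_ord i)).
have := congr1 (jprod X`_i) ks; rewrite jprodx0 jprod_sumr (bigD1 i)//= big1.
  rewrite addr0 jprodZr XE ii => /eqP; rewrite scaler_eq0 (negPf i0) orbF.
  by move/eqP.
move=> j ji; rewrite jprodZr !XE.
move/pairwiseP: t2 => /(_ (0, 0)) t2.
have [ij|ij|ij] := ltngtP i j.
- by have /eqP -> := t2 i j (ltn_ord _) (ltn_ord _) ij; rewrite scaler0.
- by rewrite jprodC; have /eqP -> := t2 j i (ltn_ord _) (ltn_ord _) ij; rewrite scaler0.
- by case/eqP: ji; apply: val_inj.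
Qed.

(** [<c1, d>] and [<c2, d>] are nonnegative with sum zero, so both vanish. *)
Lemma orth_summand c1 c2 d : c1 *o c1 = c1 -> c2 *o c2 = c2 -> d *o d = d ->
  (c1 + c2) *o d = 0 -> c1 *o d = 0.
Proof.
move=> h1 h2 dd h; apply: idem_dot_eq0 => //.
have : dotp (c1 + c2) d = 0.
  by rewrite -dd dotpC jprod_selfadj jprodC h dotp0r.
rewrite dotpDl => e; have := idem_dot_ge0 h1 dd; have := idem_dot_ge0 h2 dd.
move=> ? ?; apply/eqP; rewrite eq_le; apply/andP; split; lra.
Qed.

Lemma idem_add_orth c1 c2 : c1 *o c1 = c1 -> c2 *o c2 = c2 ->
  (c1 + c2) *o (c1 + c2) = c1 + c2 -> c1 *o c2 = 0.
Proof.
move=> h1 h2; rewrite jprodDl !jprodDr h1 h2 (jprodC c2) => e.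
apply: dotp_inj => t; have := congr1 (fun u => dotp u t) e.
rewrite !dotpDl dotp0l; lra.
Qed.

(** Idempotents that are not primitive are split in two until none is left; the dimension bounds the
    number of splittings. *)
Lemma exists_primitive_resolution x : exists2 t, idem_resolution x t &
  {in t, forall p, primitive_idempotent p.2}.
Proof.
(* [n] measures the room left below the dimension: a splitting lengthens [t] by one and lowers [n]
   by one. *)
suff H n t : (\dim {:V} < size t + n)%N -> idem_resolution x t ->
    exists2 t, idem_resolution x t & {in t, forall p, primitive_idempotent p.2}.
  have [t tx] := exists_idem_resolution x.
  by apply: (H (\dim {:V}).+1 t _ tx); rewrite addnS ltnS leq_addl.
elim: n t => [|n IH] t tn tx.
  by have := idem_resolution_size tx; lia.
have [tp|] := pselect {in t, forall p, primitive_idempotent p.2}; first by exists t.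
move=> /existsNP[[r c] /not_implyP[pt np]].
have [t1 t2 t3 t4] := tx; have [/= cc c0] := t1 _ pt.
have [c1 [c2 [[h1 h2] c10 c20 cE]]] : exists c1 c2, [/\
    Defs.idempotent c1 /\ Defs.idempotent c2, c1 != 0, c2 != 0 & c = c1 + c2].
  by apply: contrapT => ne; apply: np; split.
move: t1 t2 t3 t4 tn {tx}; have [l1 l2] := splitPr pt => t1 t2 t3 t4 tn.
have c12 : c1 *o c2 = 0 by apply: idem_add_orth => //; rewrite -cE.
have orth q : q \in l1 ++ l2 -> c *o q.2 = 0 -> c1 *o q.2 = 0 /\ c2 *o q.2 = 0.
  move=> ql; have [qq _] : q.2 *o q.2 = q.2 /\ q.2 != 0.
    by apply: t1; move: ql; rewrite !mem_cat inE => /orP[]->; rewrite ?orbT.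
  rewrite cE => e; split; first exact: (@orth_summand c1 c2).
  by apply: (@orth_summand c2 c1); rewrite // addrC.
apply: (IH (l1 ++ (r, c1) :: (r, c2) :: l2)).
  by move: tn; rewrite !size_cat /=; lia.
split.
- move=> q; rewrite mem_cat !inE => /or4P[ql|/eqP->//|/eqP->//|ql];
  by apply: t1; rewrite mem_cat inE ql ?orbT.
- move: t2; rewrite !pairwise_cat /= allrel_consr.
  move=> /and3P[/andP[a1 a2] -> /andP[b1 ->]].
  have A1 : all (fun q => (c1 *o q.2 == 0) && (c2 *o q.2 == 0)) l1.
    apply/allP => q ql; have /eqP := allP a1 _ ql.
    by rewrite jprodC => /(orth q _)[|-> ->]; rewrite ?mem_cat ?ql// eqxx.
  have B1 : all (fun q => (c1 *o q.2 == 0) && (c2 *o q.2 == 0)) l2.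
    apply/allP => q ql; have /eqP := allP b1 _ ql.
    by move=> /(orth q _)[|-> ->]; rewrite ?mem_cat ?ql ?orbT// eqxx.
  move: A1 B1; rewrite !all_predI => /andP[A1 A2] /andP[B1 B2].
  rewrite !allrel_consr c12 eqxx a2 B1 B2 !andbT /=.
  apply/andP; split; apply/allP => q ql; rewrite jprodC; first exact: (allP A1).
  exact: (allP A2).
- by move: t3; rewrite !big_cat !big_cons /= cE !addrA.
- by move: t4; rewrite !big_cat !big_cons /= cE scalerDr !addrA.
Qed.

Lemma exists_spectral_decomposition x : exists s, sorted >=%R s /\
  exists c : 'I_(size s) -> V, spectral_decomposition x (fun i => s`_i) c.
Proof.
have [t [t1 t2 t3 t4] tp] := exists_primitive_resolution x.
pose d : R * V := (0, 0).
pose leT i j := (nth d t j).1 <= (nth d t i).1.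
(* Indices are sorted rather than values, so that each idempotent follows its eigenvalue. *)
pose ix := sort leT (iota 0 (size t)).
have pix : perm_eq ix (iota 0 (size t)) by rewrite perm_sort.
have six : size ix = size t by rewrite (perm_size pix) size_iota.
have uix : uniq ix by rewrite (perm_uniq pix) iota_uniq.
have tix i : i \in ix -> (i < size t)%N by rewrite (perm_mem pix) mem_iota.
have sumE (F : R * V -> V) : \sum_(p <- t) F p = \sum_(i < size ix) F (nth d t (nth 0%N ix i)).
  rewrite (big_nth d) -[X in _ = X](big_mkord xpredT (fun i => F (nth d t (nth 0%N ix i)))).
  rewrite -(big_nth 0%N xpredT (fun i => F (nth d t i))) (perm_big _ pix) /=.
  by rewrite /index_iota subn0.
exists [seq (nth d t i).1 | i <- ix]; split.
  rewrite sorted_map; apply: (@sort_sorted _ leT) => i j; exact: le_total.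
have orth i j : (i < size t)%N -> (j < size t)%N -> i != j ->
    (nth d t i).2 *o (nth d t j).2 = 0.
  move/pairwiseP: t2 => /(_ d) t2 it jt.
  rewrite neq_ltn => /orP[]ij; first by apply/eqP/t2.
  by rewrite jprodC; apply/eqP/t2.
exists (fun i => (nth d t (nth 0%N ix i)).2).
have sm (i : 'I_(size [seq (nth d t i).1 | i <- ix])) : (i < size ix)%N.
  by rewrite -(size_map (fun i => (nth d t i).1)).
split; first split.
- by move=> i; apply: tp; rewrite mem_nth// tix// mem_nth.
- move=> i j ij; apply: orth; rewrite ?tix ?mem_nth// nth_uniq//.
- by rewrite -t3 (sumE snd); apply: esym; rewrite size_map.
- rewrite -t4 (sumE (fun p => p.1 *: p.2)); apply: esym.
  move: sm; rewrite size_map => sm.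
  by apply: eq_bigr => i _; rewrite (nth_map 0%N).
Qed.

Lemma lambdaP x : sorted >=%R (lambda x) /\
  exists c : 'I_(size (lambda x)) -> V,
    spectral_decomposition x (fun i => (lambda x)`_i) c.
Proof.
exact: (@xgetPex _ [::] [set s | sorted >=%R s /\ exists c : 'I_(size s) -> V,
  spectral_decomposition x (fun i => s`_i) c] (exists_spectral_decomposition x)).
Qed.

End SpectralTheorem.

(** * Frames and Schur multipliers *)

Section PeirceDecomposition.
Context {R : realType} {V : euclideanJordanType R}.
Implicit Types (x y z u w a b c : V).

Lemma frame_idem n (c : 'I_n -> V) i : jordan_frame c -> c i *o c i = c i.
Proof. by case=> /(_ i)[]. Qed.

Lemma frame_orth n (c : 'I_n -> V) i j : jordan_frame c -> i != j -> c i *o c j = 0.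
Proof. by case=> _ /(_ i j). Qed.

Lemma frame_neq0 n (c : 'I_n -> V) i : jordan_frame c -> c i != 0.
Proof. by case=> /(_ i)[]. Qed.

Lemma frame_sum n (c : 'I_n -> V) : jordan_frame c -> \sum_i c i = jone.
Proof. by case. Qed.

Lemma frame_eigen n (c : 'I_n -> V) (s : 'I_n -> R) i : jordan_frame c ->
  (\sum_j s j *: c j) *o c i = s i *: c i.
Proof.
move=> F; rewrite jprod_suml (bigD1 i)//= jprodZl frame_idem// big1 ?addr0// => j ji.
by rewrite jprodZl frame_orth// scaler0.
Qed.

Lemma frame_coef_inj n (c : 'I_n -> V) (s t : 'I_n -> R) i : jordan_frame c ->
  \sum_j s j *: c j = \sum_j t j *: c j -> s i = t i.
Proof.
move=> F e; have := frame_eigen t i F; rewrite -e frame_eigen// => /eqP.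
by rewrite -subr_eq0 -scalerBl scaler_eq0 (negPf (frame_neq0 i F)) orbF subr_eq0 => /eqP.
Qed.

Lemma frame_prod n (c : 'I_n -> V) (s t : 'I_n -> R) : jordan_frame c ->
  (\sum_j s j *: c j) *o (\sum_j t j *: c j) = \sum_j (s j * t j) *: c j.
Proof.
move=> F; rewrite jprod_sumr; apply: eq_bigr => j _.
by rewrite jprodZr frame_eigen// scalerA mulrC.
Qed.

Lemma spectral_pown x n (s : 'I_n -> R) (c : 'I_n -> V) k :
  spectral_decomposition x s c -> jpown x k = \sum_i s i ^+ k *: c i.
Proof.
move=> [F xE]; elim: k => [|k IH].
  by rewrite -[LHS](frame_sum F); apply: eq_bigr => i _; rewrite expr0 scale1r.
by rewrite jpownS IH xE frame_prod//; apply: eq_bigr => i _; rewrite exprS.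
Qed.

Lemma spectral_peval x n (s : 'I_n -> R) (c : 'I_n -> V) (p : {poly R}) :
  spectral_decomposition x s c -> peval x p = \sum_i p.[s i] *: c i.
Proof.
move=> sx; rewrite /peval.
under eq_bigr do rewrite (spectral_pown _ sx) scaler_sumr.
rewrite exchange_big; apply: eq_bigr => i _; rewrite horner_coef scaler_suml.
by apply: eq_bigr => j _; rewrite scalerA.
Qed.

(** A polynomial [p] that agrees with [f] on the eigenvalues of both decompositions, the chosen and
    the given one, makes both sums equal to [peval x p]. *)
Lemma spectral_jfun x n (s : 'I_n -> R) (c : 'I_n -> V) (f : R -> R) :
  spectral_decomposition x s c -> jfun f x = \sum_i f (s i) *: c i.
Proof.
move=> sx; pose S : set V := [set y | exists m (t : 'I_m -> R) (d : 'I_m -> V),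
  spectral_decomposition x t d /\ y = \sum_i f (t i) *: d i].
have [m [t [d [tx ->]]]] : S (jfun f x).
  by apply: (@xgetPex _ 0 S); exists (\sum_i f (s i) *: c i); exists n, s, c.
have [p pE] := interpolation ([seq t i | i : 'I_m] ++ [seq s i | i : 'I_n]) f.
transitivity (peval x p).
  rewrite (spectral_peval _ tx); apply: eq_bigr => i _.
  by rewrite pE// mem_cat; apply/orP; left; apply/mapP; exists i; rewrite ?mem_enum.
rewrite (spectral_peval _ sx); apply: eq_bigr => i _.
by rewrite pE// mem_cat; apply/orP; right; apply/mapP; exists i; rewrite ?mem_enum.
Qed.

(** By idempotence the coefficients of [c] in a frame are 0 or 1. A frame element with coefficient 1
    splits off from [c], so by primitivity it is [c], and the trace of [c] is 1. *)
Lemma primitive_dotp1 c : (forall x y, jdot x y = jtr (x ** y)) ->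
  primitive_idempotent c -> dotp c c = 1.
Proof.
move=> tr [cc c0 cprim]; rewrite /dotp tr cc.
pose s (i : 'I_(size (lambda c))) := (lambda c)`_i.
have [_ [f [F]]] := lambdaP c; rewrite -/s => cE.
have {}cE : c = \sum_i s i *: f i by [].
have s01 i : s i * s i = s i.
  apply: (frame_coef_inj (c := f) (s := fun i => s i * s i) (t := s)) => //.
  by rewrite -frame_prod// -cE; exact: cc.
have [i si] : exists i, s i != 0.
  apply: contrapT => /forallNP s0; case/eqP: c0; rewrite cE big1// => i _.
  by have /negP := s0 i; rewrite negbK => /eqP ->; rewrite scale0r.
have {}si : s i = 1 by apply: (mulfI si); rewrite s01 mulr1.
have cfi : c *o f i = f i by rewrite {1}cE frame_eigen// si scale1r.
have cfiE : c = f i.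
  apply/eqP; rewrite -subr_eq0; apply/negP => /negP cf0.
  apply: cprim; exists (f i), (c - f i); split=> //.
  - split; first exact: frame_idem F.
    rewrite /Defs.idempotent -[LHS]/((c - f i) *o (c - f i)) jprodBl !jprodBr.
    rewrite [f i *o c]jprodC cfi (frame_idem i F) [c *o c]cc.
    by rewrite subrr subr0.
  - exact: frame_neq0 F.
  - by rewrite addrC subrK.
have sj j : j != i -> s j = 0.
  move=> ji; have := frame_eigen s j F; rewrite -cE cfiE (frame_orth F) 1?eq_sym//.
  by move/esym/eqP; rewrite scaler_eq0 (negPf (frame_neq0 j F)) orbF => /eqP.
rewrite /jtr (big_nth 0) big_mkord (bigD1 i)//= [X in X + _]si big1 ?addr0//.
Qed.

Lemma frame_size n (c : 'I_n -> V) : (forall x y, jdot x y = jtr (x ** y)) ->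
  jordan_frame c -> n%:R = dotp (jone : V) jone.
Proof.
move=> tr F; rewrite -[X in dotp X _](frame_sum F) dotp_suml.
transitivity (\sum_(i < n) (1 : R)); first by rewrite sumr_const card_ord.
apply: eq_bigr => i _; rewrite -(primitive_dotp1 tr (c := c i)); last by case: F.
by rewrite -[in RHS](frame_idem i F) jprod_selfadj jprodx1.
Qed.

(** Sums run over ordered pairs: along a frame, for [i != j] this is half of the projection onto the
    Peirce space of the pair, and for [i = j] it is the projection onto the eigenvalue 1 of
    [c i]. *)
Definition peirce n (c : 'I_n -> V) i j x : V :=
  2 *: (c i *o (c j *o x)) - (i == j)%:R *: (c i *o x).

Definition schur n (c : 'I_n -> V) (m : 'I_n -> 'I_n -> R) x : V :=
  \sum_i \sum_j m i j *: peirce c i j x.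

Lemma idem_peirce1 a x : a *o a = a ->
  a *o (2 *: (a *o (a *o x)) - a *o x) = 2 *: (a *o (a *o x)) - a *o x.
Proof.
move=> aa; have e := idem_cubic x aa; apply: dotp_inj => t.
by move/(congr1 (fun u => dotp u t)): e; rewrite !dotpE; lra.
Qed.

(** The eigenvalue 1 comes from [idem_peirce1], the eigenvalue 1/2 from [orth_idem_sq], and three
    distinct indices give 0 by [orth_idem_triple]. *)
Lemma peirce_eigen n (c : 'I_n -> V) i j k x : jordan_frame c ->
  c k *o peirce c i j x = (((k == i)%:R + (k == j)%:R) / 2) *: peirce c i j x.
Proof.
move=> F; have I l := frame_idem l F; have O l l' := @frame_orth _ c l l' F.
have C l l' y : c l *o (c l' *o y) = c l' *o (c l *o y).
  by have [->//|ll'] := eqVneq l l'; apply: orth_idem_comm => //; apply: O.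
have S l l' y : l != l' -> c l *o (c l *o (c l' *o y)) = (1 / 2) *: (c l *o (c l' *o y)).
  move=> ll'; rewrite [in RHS](orth_idem_sq _ (I l) (I l') (O _ _ ll')).
  by rewrite scalerA mul1r mulVf ?pnatr_eq0// scale1r.
rewrite /peirce; have [<-|ij] := eqVneq i j.
  rewrite scale1r; have [->|ki] := eqVneq k i.
    by rewrite idem_peirce1// -mulr2n -mulr_natr mul1r mulfV ?pnatr_eq0// scale1r.
  rewrite addr0 mul0r scale0r jprodBr jprodZr !(C k) S 1?eq_sym// scalerA.
  by rewrite mul1r mulfV ?pnatr_eq0// scale1r subrr.
rewrite scale0r subr0 jprodZr.
have [->|ki] := eqVneq k i.
  by rewrite (negPf ij) addr0 S// !scalerA mulrC.
have [->|kj] := eqVneq k j.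
  by rewrite add0r ![c i *o (c j *o _)](C i j) S 1?eq_sym// !scalerA mulrC.
rewrite addr0 mul0r scale0r orth_idem_triple ?scaler0//; exact: O.
Qed.

Lemma peirce_sum n (c : 'I_n -> V) x : jordan_frame c ->
  \sum_i \sum_j peirce c i j x = x.
Proof.
move=> F; rewrite /peirce.
transitivity (\sum_i (2 *: (c i *o x) - c i *o x)).
  apply: eq_bigr => i _; rewrite big_split /= -scaler_sumr -jprod_sumr -jprod_suml.
  rewrite frame_sum// jprod1x; congr (_ + _).
  rewrite (bigD1 i)//= eqxx scale1r big1 ?addr0// => j ji.
  by rewrite eq_sym (negPf ji) scale0r oppr0.
rewrite big_split /= -scaler_sumr sumrN -jprod_suml frame_sum// jprod1x.
by rewrite scaler_nat mulr2n addrK.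
Qed.

(** * Linearity and composition of Schur multipliers *)

Lemma peirceD n (c : 'I_n -> V) i j x y :
  peirce c i j (x + y) = peirce c i j x + peirce c i j y.
Proof. by rewrite /peirce !jprodDr !scalerDr opprD addrACA. Qed.

Lemma peirceZ n (c : 'I_n -> V) i j k x : peirce c i j (k *: x) = k *: peirce c i j x.
Proof.
rewrite /peirce !jprodZr scalerBr !scalerA.
by rewrite ![k * _]mulrC.
Qed.

Lemma schurD n (c : 'I_n -> V) m x y : schur c m (x + y) = schur c m x + schur c m y.
Proof.
rewrite /schur -big_split; apply: eq_bigr => i _; rewrite -big_split.
by apply: eq_bigr => j _; rewrite peirceD scalerDr.
Qed.

Lemma schurZ n (c : 'I_n -> V) m k x : schur c m (k *: x) = k *: schur c m x.
Proof.
rewrite /schur scaler_sumr; apply: eq_bigr => i _; rewrite scaler_sumr.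
by apply: eq_bigr => j _; rewrite peirceZ !scalerA mulrC.
Qed.

Lemma schur_suml n (c : 'I_n -> V) m I (r : seq I) (F : I -> V) :
  schur c m (\sum_(i <- r) F i) = \sum_(i <- r) schur c m (F i).
Proof.
apply: (big_morph (schur c m)) => [x y|]; first exact: schurD.
by have := schurZ c m 0 0; rewrite !scale0r.
Qed.

Lemma eq_schur n (c : 'I_n -> V) m1 m2 x : (forall i j, m1 i j = m2 i j) ->
  schur c m1 x = schur c m2 x.
Proof. by move=> e; apply: eq_bigr => i _; apply: eq_bigr => j _; rewrite e. Qed.

Lemma sum_delta n (i : 'I_n) (f : 'I_n -> R) : \sum_k f k * (k == i)%:R = f i.
Proof.
rewrite (bigD1 i)//= eqxx mulr1 big1 ?addr0// => j ji.
by rewrite (negPf ji) mulr0.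
Qed.

(** Stated for any joint eigenvector, to cover the Peirce components and, with [i = j], the frame
    elements themselves. *)
Lemma schur_eigen n (c : 'I_n -> V) (m : 'I_n -> 'I_n -> R) i j y :
  (forall i j, m i j = m j i) ->
  (forall k, c k *o y = (((k == i)%:R + (k == j)%:R) / 2) *: y) ->
  schur c m y = m i j *: y.
Proof.
move=> msym yE; rewrite /schur.
pose th k : R := ((k == i)%:R + (k == j)%:R) / 2.
have pE k l : peirce c k l y = (2 * th k * th l - (l == k)%:R * th k) *: y.
  rewrite /peirce !yE jprodZr yE !scalerA -scalerBl; congr (_ *: _).
  by rewrite /th [l == k]eq_sym; ring.
transitivity (\sum_k (th k * (m k i + m k j - m k k)) *: y).
  apply: eq_bigr => k _; under eq_bigr do rewrite pE scalerA.
  rewrite -scaler_suml; congr (_ *: _).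
  rewrite (eq_bigr (fun l => th k * (m k l * (l == i)%:R) + th k * (m k l * (l == j)%:R)
      - th k * (m k l * (l == k)%:R))); last by move=> l _; rewrite /th; field.
  by rewrite !big_split /= sumrN -!mulr_sumr !sum_delta; ring.
rewrite -scaler_suml; congr (_ *: _).
rewrite (eq_bigr (fun k => (m k i + m k j - m k k) / 2 * (k == i)%:R +
   (m k i + m k j - m k k) / 2 * (k == j)%:R)); last by move=> k _; rewrite /th; field.
by rewrite big_split /= !sum_delta (msym j i); field.
Qed.

Lemma schur_peirce n (c : 'I_n -> V) m i j x : jordan_frame c ->
  (forall i j, m i j = m j i) -> schur c m (peirce c i j x) = m i j *: peirce c i j x.
Proof. by move=> F ms; apply: schur_eigen => // k; apply: peirce_eigen. Qed.

Lemma schur_comp n (c : 'I_n -> V) m1 m2 x : jordan_frame c ->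
  (forall i j, m1 i j = m1 j i) ->
  schur c m1 (schur c m2 x) = schur c (fun i j => m1 i j * m2 i j) x.
Proof.
move=> F ms; rewrite {2}/schur schur_suml; apply: eq_bigr => i _.
rewrite schur_suml; apply: eq_bigr => j _.
by rewrite schurZ schur_peirce// scalerA mulrC.
Qed.

Lemma schur1 n (c : 'I_n -> V) x : jordan_frame c -> schur c (fun _ _ => 1) x = x.
Proof.
move=> F; rewrite -[RHS](peirce_sum x F); apply: eq_bigr => i _.
by apply: eq_bigr => j _; rewrite scale1r.
Qed.

Lemma jprod_schur n (c : 'I_n -> V) (s : 'I_n -> R) x : jordan_frame c ->
  (\sum_k s k *: c k) *o x = schur c (fun i j => (s i + s j) / 2) x.
Proof.
move=> F; rewrite -[in LHS](peirce_sum x F) jprod_sumr; apply: eq_bigr => i _.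
rewrite jprod_sumr; apply: eq_bigr => j _; rewrite jprod_suml.
under eq_bigr do rewrite jprodZl peirce_eigen// scalerA.
rewrite -scaler_suml; congr (_ *: _).
rewrite (eq_bigr (fun k => s k / 2 * (k == i)%:R + s k / 2 * (k == j)%:R)); last first.
  by move=> k _; field.
by rewrite big_split /= !sum_delta; field.
Qed.

Lemma schurB n (c : 'I_n -> V) m1 m2 x :
  schur c m1 x - schur c m2 x = schur c (fun i j => m1 i j - m2 i j) x.
Proof.
rewrite /schur -sumrB; apply: eq_bigr => i _; rewrite -sumrB.
by apply: eq_bigr => j _; rewrite scalerBl.
Qed.

Lemma schurDl n (c : 'I_n -> V) m1 m2 x :
  schur c m1 x + schur c m2 x = schur c (fun i j => m1 i j + m2 i j) x.
Proof.
rewrite /schur -big_split; apply: eq_bigr => i _; rewrite -big_split.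
by apply: eq_bigr => j _; rewrite scalerDl.
Qed.

Lemma schurZl n (c : 'I_n -> V) k m x :
  k *: schur c m x = schur c (fun i j => k * m i j) x.
Proof.
rewrite /schur scaler_sumr; apply: eq_bigr => i _; rewrite scaler_sumr.
by apply: eq_bigr => j _; rewrite scalerA.
Qed.

Lemma peirce_adj n (c : 'I_n -> V) i j x y :
  dotp (peirce c i j x) y = dotp x (peirce c j i y).
Proof.
rewrite /peirce !(dotpDl, dotpNl, dotpZl, dotpDr, dotpNr, dotpZr) eq_sym.
rewrite !jprod_selfadj.
by have [->|] := eqVneq i j; rewrite ?mul0r.
Qed.

Lemma schur_selfadj n (c : 'I_n -> V) m x y : (forall i j, m i j = m j i) ->
  dotp (schur c m x) y = dotp x (schur c m y).
Proof.
move=> ms; rewrite /schur dotp_suml dotp_sumr.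
under eq_bigr do rewrite dotp_suml.
under [RHS]eq_bigr do rewrite dotp_sumr.
rewrite exchange_big; apply: eq_bigr => i _; apply: eq_bigr => j _.
by rewrite dotpZl dotpZr peirce_adj ms.
Qed.

Lemma schur_frame n (c : 'I_n -> V) m k : jordan_frame c ->
  (forall i j, m i j = m j i) -> schur c m (c k) = m k k *: c k.
Proof.
move=> F ms; apply: schur_eigen => // l; have [->|lk] := eqVneq l k.
  by rewrite frame_idem// -mulr2n -mulr_natr mul1r mulfV ?pnatr_eq0// scale1r.
by rewrite frame_orth// addr0 mul0r scale0r.
Qed.

End PeirceDecomposition.

(** * Positive Schur multipliers and majorization *)

Section Positivity.
Context {R : realType} {V : euclideanJordanType R}.
Implicit Types (x y z u w a b c : V).

(** The cone of elements with nonnegative eigenvalues, described by pairing with idempotents: a form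
    that passes directly to sums and limits. *)
Definition jnonneg x : Prop := forall d, d *o d = d -> 0 <= dotp x d.

Lemma spectral_nonneg x n (s : 'I_n -> R) (f : 'I_n -> V) :
  spectral_decomposition x s f -> (forall i, 0 <= s i) -> jnonneg x.
Proof.
move=> [F ->] s0 d dd; rewrite dotp_suml; apply: sumr_ge0 => i _.
by rewrite dotpZl mulr_ge0// idem_dot_ge0// frame_idem.
Qed.

Definition schur_positive n (c : 'I_n -> V) m : Prop :=
  forall x, jnonneg x -> jnonneg (schur c m x).

Lemma eq_schur_positive n (c : 'I_n -> V) m1 m2 : (forall i j, m1 i j = m2 i j) ->
  schur_positive c m1 -> schur_positive c m2.
Proof. by move=> e H x /H x0 d dd; rewrite -(eq_schur c x e); exact: x0. Qed.

Lemma schur_positive1 n (c : 'I_n -> V) : jordan_frame c ->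
  schur_positive c (fun _ _ => 1).
Proof. by move=> F x x0; rewrite schur1. Qed.

Lemma schur_positiveM n (c : 'I_n -> V) m1 m2 : jordan_frame c ->
  (forall i j, m1 i j = m1 j i) -> schur_positive c m1 -> schur_positive c m2 ->
  schur_positive c (fun i j => m1 i j * m2 i j).
Proof. by move=> F ms H1 H2 x /H2/H1; rewrite schur_comp. Qed.

Lemma schur_positiveX n (c : 'I_n -> V) m k : jordan_frame c ->
  (forall i j, m i j = m j i) -> schur_positive c m ->
  schur_positive c (fun i j => m i j ^+ k).
Proof.
move=> F ms H; elim: k => [|k IH].
  by apply: eq_schur_positive (schur_positive1 F) => i j; rewrite expr0.
apply: eq_schur_positive (schur_positiveM F ms H IH) => i j.
by rewrite exprS.
Qed.

Lemma schur_positive_lin n (c : 'I_n -> V) m1 m2 (k1 k2 : R) : 0 <= k1 -> 0 <= k2 ->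
  schur_positive c m1 -> schur_positive c m2 ->
  schur_positive c (fun i j => k1 * m1 i j + k2 * m2 i j).
Proof.
move=> k10 k20 H1 H2 x x0 d dd.
rewrite -(schurDl c (fun i j => k1 * m1 i j)) -!schurZl dotpDl !dotpZl.
by rewrite addr_ge0// mulr_ge0//; [apply: H1|apply: H2].
Qed.

Lemma cvg_sumr I (r : seq I) (f : I -> nat -> R) (l : I -> R) :
  (forall i, f i @ \oo --> l i) ->
  (fun k => \sum_(i <- r) f i k) @ \oo --> \sum_(i <- r) l i.
Proof.
move=> fl; elim: r => [|i r IH].
  by rewrite big_nil; under eq_fun do rewrite big_nil; exact: cvg_cst.
rewrite big_cons; under eq_fun do rewrite big_cons.
by apply: cvgD; [exact: fl|exact: IH].
Qed.

(** Paired with a fixed idempotent, [schur c m x] is a finite linear combination of the entries of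
    [m], so nonnegativity passes to the limit. *)
Lemma schur_positive_cvg n (c : 'I_n -> V) (m : nat -> 'I_n -> 'I_n -> R) l :
  (\forall k \near \oo, schur_positive c (m k)) ->
  (forall i j, (fun k => m k i j) @ \oo --> l i j) ->
  schur_positive c l.
Proof.
move=> mP ml x x0 d dd.
have E g : dotp (schur c g x) d = \sum_i \sum_j g i j * dotp (peirce c i j x) d.
  rewrite /schur dotp_suml; apply: eq_bigr => i _; rewrite dotp_suml.
  by apply: eq_bigr => j _; rewrite dotpZl.
have lim : (fun k => dotp (schur c (m k) x) d) @ \oo --> dotp (schur c l x) d.
  rewrite E; under eq_fun do rewrite E.
  apply: cvg_sumr => i; apply: cvg_sumr => j.
  by apply: cvgM; [exact: ml|exact: cvg_cst].
rewrite -(cvg_lim (@Rhausdorff R) lim).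
apply: limr_ge; first by apply/cvg_ex; exists (dotp (schur c l x) d).
by apply: filterS mP => k; apply.
Qed.

(* If [L_u y = x] and [f] is a frame of eigenvectors of [y] with eigenvalues [mu],
   then [<x, f_k> = <u, y f_k> = mu_k <u, f_k>]. *)
Lemma lyapunov_inverse_positive n (c : 'I_n -> V) (u : 'I_n -> R) : jordan_frame c ->
  (forall i, 0 < u i) -> schur_positive c (fun i j => 2 / (u i + u j)).
Proof.
move=> F u0 x x0; set y := schur _ _ _; set b := \sum_k u k *: c k.
have by_ : b *o y = x.
  rewrite jprod_schur// schur_comp//; last by move=> i j; rewrite addrC.
  rewrite -[RHS](schur1 x F); apply: eq_schur => i j.
  by field; rewrite gt_eqF ?addr_gt0.
have [_ [f [G yE]]] := lambdaP y.
apply: (spectral_nonneg (conj G yE)) => i.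
have I := frame_idem i G.
have xf : dotp x (f i) = (lambda y)`_i * dotp b (f i).
  by rewrite -by_ jprodC jprod_selfadj {1}yE (frame_eigen _ i G) dotpZr.
(* The numbers [<c k, f i>] are nonnegative with sum [|f i|^2 > 0]; the positive weights [u k] keep
   the sum positive. *)
have bf : 0 < dotp b (f i).
  have ff : 0 < dotp (f i) (f i) by apply: dotp_gt0; apply: frame_neq0 G.
  have sumE : dotp (f i) (f i) = \sum_k dotp (c k) (f i).
    by rewrite -dotp_suml (frame_sum F) -{3}I dotpC jprod_selfadj jprodx1.
  have bE : dotp b (f i) = \sum_k u k * dotp (c k) (f i).
    by rewrite dotp_suml; apply: eq_bigr => k _; rewrite dotpZl.
  have cf k : 0 <= dotp (c k) (f i) by apply: idem_dot_ge0 => //; exact: frame_idem.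
  rewrite lt0r bE sumr_ge0 ?andbT => [|k _]; last by rewrite mulr_ge0// ltW.
  apply: contraL ff => /eqP/psumr_eq0P bz; rewrite sumE big1 ?ltxx// => k _.
  have /eqP := bz (fun k _ => mulr_ge0 (ltW (u0 k)) (cf k)) k isT.
  by rewrite mulf_eq0 (gt_eqF (u0 k)) => /eqP.
by have := x0 _ I; rewrite xf pmulr_lge0.
Qed.

(** * Doubly stochastic matrices and majorization *)

Lemma le_sum_sorted n (mu la : 'I_n -> R) (W : 'I_n -> 'I_n -> R) K :
  (forall i j : 'I_n, (i <= j)%N -> la j <= la i) ->
  (forall i j, 0 <= W i j) -> (forall i, \sum_j W i j = 1) ->
  (forall j, \sum_i W i j = 1) -> (forall i, mu i = \sum_j W i j * la j) ->
  (K < n)%N ->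
  \sum_(i < n | (i <= K)%N) mu i <= \sum_(i < n | (i <= K)%N) la i.
Proof.
move=> las W0 Wr Wc muE Kn; pose k0 := Ordinal Kn.
(* The mass that the first [K.+1] rows put on column [j]: it lies between 0 and 1 and has total
   [K.+1]. *)
pose w j := \sum_(i < n | (i <= K)%N) W i j.
have w0 j : 0 <= w j by apply: sumr_ge0.
have w1 j : w j <= 1.
  by rewrite -(Wc j) [leRHS](bigID (fun i : 'I_n => (i <= K)%N)) lerDl sumr_ge0.
have -> : \sum_(i < n | (i <= K)%N) mu i = \sum_j w j * la j.
  under eq_bigr do rewrite muE.
  by rewrite exchange_big; apply: eq_bigr => j _; rewrite -mulr_suml.
have sw : \sum_j w j = \sum_(j < n) (j <= K)%N%:R.
  rewrite exchange_big [RHS](bigID (fun i : 'I_n => (i <= K)%N)) /=.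
  rewrite [X in _ = _ + X]big1 ?addr0; last by move=> j /negPf ->.
  by apply: eq_bigr => i ->; rewrite Wr.
rewrite [leRHS]big_mkcond -subr_ge0 -sumrB.
(* Both families of weights have the same total, so [la k0] can be subtracted from every [la j];
   then both factors are nonnegative up to [K] and nonpositive beyond. *)
have -> : \sum_(j < n) ((if (j <= K)%N then la j else 0) - w j * la j) =
    \sum_(j < n) ((j <= K)%N%:R - w j) * (la j - la k0).
  transitivity (\sum_(j < n) (((j <= K)%N%:R - w j) * (la j - la k0) +
      ((j <= K)%N%:R - w j) * la k0)).
    by apply: eq_bigr => j _; case: ifP => _; rewrite /=; ring.
  by rewrite big_split /= -mulr_suml sumrB sw subrr mul0r addr0.
apply: sumr_ge0 => j _; case: leqP => jK.
  by rewrite mulr_ge0 ?subr_ge0//; exact: las.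
by rewrite mulr_le0 ?sub0r ?oppr_le0 ?subr_le0//; apply: las; exact: ltnW.
Qed.

Lemma decr_id (s : seq R) : sorted >=%R s -> decr s = s.
Proof.
move=> ss; apply: sorted_sort => //.
by move=> a b d ba ad; exact: le_trans ad ba.
Qed.

Lemma sorted_nth_le (s : seq R) i j : sorted >=%R s -> (i <= j < size s)%N ->
  s`_j <= s`_i.
Proof.
move=> ss /andP[ij js].
have tr : transitive (>=%R : rel R) by move=> a b d ba ad; exact: le_trans ad ba.
have rf : reflexive (>=%R : rel R) by move=> a; exact: lexx.
have H := sorted_leq_nth tr rf 0 ss.
exact: (H i j (leq_ltn_trans ij js) js ij).
Qed.

Lemma lambda_frame n x : (forall x y, jdot x y = jtr (x ** y)) ->
  n%:R = dotp (jone : V) jone ->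
  size (lambda x) = n /\ exists f : 'I_n -> V,
    spectral_decomposition x (fun i => (lambda x)`_i) f.
Proof.
move=> tr nE; have [_ [f fx]] := lambdaP x.
have sn : size (lambda x) = n.
  by apply/eqP; rewrite -(eqr_nat R) nE (frame_size tr (proj1 fx)).
by split=> //; subst n; exists f.
Qed.

Lemma frame_dot_coef n (f : 'I_n -> V) (s : 'I_n -> R) i :
  (forall x y, jdot x y = jtr (x ** y)) -> jordan_frame f ->
  dotp (\sum_j s j *: f j) (f i) = s i.
Proof.
move=> tr F; rewrite -(frame_idem i F) dotpC jprod_selfadj jprodC frame_eigen//.
by rewrite dotpZr primitive_dotp1 ?mulr1//; case: F.
Qed.

(** Between frames of [x] and of its image, [W] carries one list of eigenvalues to the other.
    Positivity makes its entries nonnegative; fixing the unit and being self-adjoint give row and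
    column sums 1. *)
Lemma schur_majorized n (c : 'I_n -> V) m x :
  (forall x y, jdot x y = jtr (x ** y)) -> jordan_frame c ->
  (forall i j, m i j = m j i) -> (forall i, m i i = 1) -> schur_positive c m ->
  schur c m x \prec x.
Proof.
move=> tr F ms m1 mP; set y := schur c m x.
have De : schur c m jone = jone.
  rewrite -(frame_sum F) schur_suml; apply: eq_bigr => i _.
  by rewrite schur_frame// m1 scale1r.
have nE := frame_size tr F.
have [szy [g [G yE]]] := lambda_frame y tr nE.
have [szx [f [E xE]]] := lambda_frame x tr nE.
have [sy _] := lambdaP y; have [sx _] := lambdaP x.
rewrite /jmajorized /majorized !decr_id//.
pose W i j := dotp (schur c m (f j)) (g i).
have W0 i j : 0 <= W i j.
  apply: mP => [d dd|]; last exact: frame_idem G.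
  by apply: idem_dot_ge0 => //; exact: frame_idem E.
have Wr i : \sum_j W i j = 1.
  rewrite -dotp_suml -schur_suml (frame_sum E) De.
  rewrite -{1}(frame_idem i G) dotpC jprod_selfadj jprodx1.
  by apply: primitive_dotp1 => //; case: G.
have Wc j : \sum_i W i j = 1.
  rewrite -dotp_sumr (frame_sum G) schur_selfadj// De.
  rewrite -{1}(frame_idem j E) jprod_selfadj jprodx1.
  by apply: primitive_dotp1 => //; case: E.
have muE (i : 'I_n) : (lambda y)`_i = \sum_(j < n) W i j * (lambda x)`_j.
  transitivity (dotp y (g i)).
    by rewrite [in RHS]yE (frame_dot_coef _ i tr G).
  rewrite /y [in LHS]xE schur_suml dotp_suml; apply: eq_bigr => j _.
  by rewrite schurZ dotpZl mulrC.
split.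
- by rewrite szx szy.
- move=> [//|k] /= kn; rewrite szy in kn.
  (* The first [k.+1] entries are those of index at most [k]. *)
  rewrite (big_ord_widen _ (fun i => (lambda y)`_i) kn).
  rewrite (big_ord_widen _ (fun i => (lambda x)`_i) kn).
  apply: (@le_sum_sorted n _ (fun i : 'I_n => (lambda x)`_i) W) => // i j ij.
  by apply: sorted_nth_le => //; rewrite ij szx ltn_ord.
- rewrite szx szy; under eq_bigr do rewrite muE.
  rewrite exchange_big; apply: eq_bigr => j _.
  by rewrite -mulr_suml Wc mul1r.
Qed.

End Positivity.

(** * Hyperbolic kernels *)

Section HyperbolicKernels.
Context {R : realType} {V : euclideanJordanType R}.
Implicit Types (v : R).

Lemma cvg_expR_comp (f : nat -> R) (l : R) :
  f @ \oo --> l -> (fun k => expR (f k)) @ \oo --> expR l.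
Proof. by move=> fl; apply: continuous_cvg => //; exact: continuous_expR. Qed.

(** Squeeze with [y = e / k.+1]: [1 - y <= exp (- y)] gives the lower bound, and [1 / (1 - y) = 1 +
    y / (1 - y) <= exp (y / (1 - y))] the upper one. *)
Lemma cvg_expR_inv_pow (e : R) :
  (fun k => (1 - e * harmonic k)^-1 ^+ k.+1) @ \oo --> expR e.
Proof.
have inv1 : (fun k => (1 - e * harmonic k : R)^-1) @ \oo --> (1 : R).
  rewrite -[X in _ --> X]invr1; apply: cvgV; first exact: oner_neq0.
  rewrite -[X in _ --> X]subr0 -[X in 1 - X](mulr0 e).
  by apply: cvgB; [exact: cvg_cst|apply: cvgM; [exact: cvg_cst|exact: cvg_harmonic]].
apply: (@squeeze_cvgr _ _ _ _ (fun=> expR e) (fun k => expR (e * (1 - e * harmonic k)^-1))).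
- near=> k.
  have ek : `|e| < k.+1%:R.
    by apply: (@lt_trans _ _ k%:R); [near: k; exact: nbhs_infty_gtr|rewrite ltr_nat].
  rewrite /harmonic /=; set N : R := k.+1%:R in ek *; set y := e / N.
  have N0 : 0 < N by rewrite ltr0n.
  have y1 : y < 1 by rewrite ltr_pdivrMr// mul1r (le_lt_trans (ler_norm _)).
  have y0 : 0 < 1 - y by rewrite subr_gt0.
  have Ny : N * y = e by rewrite /y mulrC divfK ?gt_eqF.
  apply/andP; split.
    rewrite -[in leLHS]Ny mulrC expRM_natr lerXn2r ?nnegrE ?expR_ge0 ?invr_ge0 ?(ltW y0)//.
    by rewrite -[y in expR y]opprK expRN lef_pV2 ?posrE ?expR_gt0// expR_ge1Dx.
  have -> : e * (1 - y)^-1 = y * (1 - y)^-1 * N by rewrite -{1}Ny; ring.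
  rewrite expRM_natr lerXn2r ?nnegrE ?expR_ge0 ?invr_ge0 ?(ltW y0)//.
  have E : (1 - y)^-1 = 1 + y * (1 - y)^-1 by field; rewrite gt_eqF.
  by rewrite {1}E expR_ge1Dx.
- exact: cvg_cst.
- rewrite -[X in _ --> expR X]mulr1.
  by apply: cvg_expR_comp; apply: cvgM => //; exact: cvg_cst.
Unshelve. all: by end_near.
Qed.

Lemma expR_add_positive n (c : 'I_n -> V) (s : 'I_n -> R) : jordan_frame c ->
  schur_positive c (fun i j => expR (s i + s j)).
Proof.
(* The factor 2 makes the mean of [u k i] and [u k j] equal to [1 - (s i + s j) / k.+1]. *)
move=> F; pose u (k : nat) i : R := 1 - 2 * s i * harmonic k.
apply: (@schur_positive_cvg _ _ _ _ (fun k i j => (2 / (u k i + u k j)) ^+ k.+1)).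
  near=> k; apply: schur_positiveX => //; first by move=> i j; rewrite addrC.
  apply: lyapunov_inverse_positive => // i.
  (* A bound independent of [i], so that all [u k i] are positive from the same [k] on. *)
  have sk : \sum_i `|2 * s i| < k.+1%:R.
    by apply: (@lt_trans _ _ k%:R); [near: k; exact: nbhs_infty_gtr|rewrite ltr_nat].
  rewrite subr_gt0 /harmonic ltr_pdivrMr ?ltr0n// mul1r.
  apply: le_lt_trans sk; rewrite (bigD1 i)//=.
  by rewrite (le_trans (ler_norm _))// lerDl sumr_ge0.
move=> i j; under eq_fun => k.
  rewrite (_ : 2 / _ = (1 - (s i + s j) * harmonic k)^-1); first over.
  have -> : u k i + u k j = 2 * (1 - (s i + s j) * harmonic k).
    by rewrite /u; move: (harmonic k) => h; ring.
  by rewrite invfM mulrA mulfV ?mul1r ?pnatr_eq0.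
exact: cvg_expR_inv_pow.
Unshelve. all: by end_near.
Qed.

(** * Hyperbolic functions *)

Definition cosh (v : R) : R := (expR v + expR (- v)) / 2.

(** The function [sinh v / v], extended by its limit at 0. *)
Definition sinhc (v : R) : R := if v == 0 then 1 else (expR v - expR (- v)) / (2 * v).

Lemma cosh_gt0 v : 0 < cosh v.
Proof. by rewrite divr_gt0 ?addr_gt0 ?expR_gt0. Qed.

Lemma coshN v : cosh (- v) = cosh v.
Proof. by rewrite /cosh opprK addrC. Qed.

Lemma sinhcN v : sinhc (- v) = sinhc v.
Proof.
rewrite /sinhc oppr_eq0; case: eqP => // /eqP v0; rewrite opprK.
by field.
Qed.

(** A crude bound, enough for positivity and for the limit 1 at 0. For [v > 0] it is
    [1 + t <= exp t] at [t = 2 v] and at [t = - 2 v]. *)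
Lemma sinhc_bounds v : expR (- `|v|) <= sinhc v <= expR `|v|.
Proof.
wlog v0 : v / 0 <= v.
  move=> H; have [/H//|/ltW v0] := leP 0 v.
  by rewrite -sinhcN -normrN; apply: H; rewrite oppr_ge0.
rewrite (ger0_norm v0) /sinhc; case: eqP => [->|/eqP vn0].
  by rewrite oppr0 expR0 lexx.
have {v0 vn0}v0 : 0 < v by rewrite lt0r vn0.
rewrite ler_pdivlMr ?ler_pdivrMr ?mulr_gt0//.
have e1 := expR_ge1Dx (2 * v); have e2 := expR_ge1Dx (- (2 * v)).
have h1 : expR v = expR (- v) * expR (2 * v) by rewrite -expRD; congr expR; ring.
have h2 : expR (- v) = expR v * expR (- (2 * v)) by rewrite -expRD; congr expR; ring.
have p1 := expR_gt0 v; have p2 := expR_gt0 (- v).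
apply/andP; split.
  rewrite h1 -subr_ge0 (_ : _ - _ = expR (- v) * (expR (2 * v) - (1 + 2 * v))).
    by rewrite mulr_ge0 ?subr_ge0// ltW.
  by ring.
rewrite h2 -subr_ge0 (_ : _ - _ = expR v * (expR (- (2 * v)) - (1 - 2 * v))).
  by rewrite mulr_ge0 ?subr_ge0// ltW.
by ring.
Qed.

Lemma sinhc_gt0 v : 0 < sinhc v.
Proof. by have /andP[+ _] := sinhc_bounds v; apply: lt_le_trans; exact: expR_gt0. Qed.

Lemma sinhc_half v : sinhc v = sinhc (v / 2) * cosh (v / 2).
Proof.
rewrite /sinhc mulf_eq0 invr_eq0 pnatr_eq0 orbF; case: eqP => [->|/eqP v0].
  by rewrite /cosh mul0r oppr0 expR0; field.
have e1 : expR v = expR (v / 2) ^+ 2 by rewrite expr2 -expRD; congr expR; field.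
have e2 : expR (- v) = expR (- (v / 2)) ^+ 2 by rewrite expr2 -expRD; congr expR; field.
by rewrite e1 e2 /cosh; field.
Qed.

Lemma cosh_half v : 2 * cosh (v / 2) ^+ 2 = cosh v + 1.
Proof.
have e1 : expR v = expR (v / 2) ^+ 2 by rewrite expr2 -expRD; congr expR; field.
have e2 : expR (- v) = expR (- (v / 2)) ^+ 2 by rewrite expr2 -expRD; congr expR; field.
have e3 : expR (v / 2) * expR (- (v / 2)) = 1 by rewrite -expRD subrr expR0.
have -> : cosh v + 1 = (expR v + expR (- v) + 2 * (expR (v / 2) * expR (- (v / 2)))) / 2.
  by rewrite e3 /cosh; field.
by rewrite e1 e2 /cosh; field.
Qed.

Lemma cvg_half_pow v : (fun k => v / 2 ^+ k : R) @ \oo --> (0 : R).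
Proof.
rewrite -[X in _ --> X](mulr0 v); apply: cvgM; first exact: cvg_cst.
under eq_fun do rewrite -exprVn.
by apply: cvg_expr; rewrite ger0_norm ?invr_ge0// invf_lt1// ltr1n.
Qed.

Lemma cvg_cosh_half_pow v : (fun k => cosh (v / 2 ^+ k)) @ \oo --> (1 : R).
Proof.
rewrite [X in _ --> X](_ : 1 = (expR 0 + expR (- 0)) / 2); last first.
  by rewrite oppr0 expR0; field.
apply: cvgM; last exact: cvg_cst.
apply: cvgD; apply: cvg_expR_comp; first exact: cvg_half_pow.
by apply: cvgN; exact: cvg_half_pow.
Qed.

Lemma cvg_sinhc_half_pow v : (fun k => sinhc (v / 2 ^+ k)) @ \oo --> (1 : R).
Proof.
have a0 : (fun k => `|v / 2 ^+ k|) @ \oo --> (0 : R).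
  by rewrite -[X in _ --> X](@normr0 _ R); apply: cvg_norm; exact: cvg_half_pow.
apply: (@squeeze_cvgr _ _ _ _ (fun k => expR (- `|v / 2 ^+ k|)) (fun k => expR `|v / 2 ^+ k|)).
- by apply: nearW => k; exact: sinhc_bounds.
- rewrite -[X in _ --> X](@expR0 R) -[X in expR X]oppr0.
  by apply: cvg_expR_comp; exact: cvgN.
- rewrite -[X in _ --> X](@expR0 R).
  exact: cvg_expR_comp.
Qed.

(** Quantifying over all [s] allows [s] to be rescaled, so that [v] can be halved in [phi v]. *)
Definition diff_positive n (c : 'I_n -> V) (phi : R -> R) : Prop :=
  forall s : 'I_n -> R, schur_positive c (fun i j => phi (s i - s j)).

Lemma even_diff n (s : 'I_n -> R) (phi : R -> R) i j :
  (forall v, phi (- v) = phi v) -> phi (s i - s j) = phi (s j - s i).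
Proof. by move=> ev; rewrite -ev opprB. Qed.

(* Iterating [phi v = phi (v/2) psi v] writes [phi] as the limit of the products
   [psi v * psi (v/2) * ... * psi (v/2^N)]. *)
Lemma diff_positive_product n (c : 'I_n -> V) (phi psi : R -> R) : jordan_frame c ->
  (forall v, psi (- v) = psi v) -> (forall v, phi v != 0) ->
  (forall v, phi v = phi (v / 2) * psi v) ->
  (forall v, (fun k => phi (v / 2 ^+ k)) @ \oo --> (1 : R)) ->
  diff_positive c psi -> diff_positive c phi.
Proof.
move=> F ev phi0 phiE phi1 P s.
have quot k v : \prod_(i < k) psi (v / 2 ^+ i) = phi v / phi (v / 2 ^+ k).
  elim: k => [|k IH]; first by rewrite big_ord0 expr0 divr1 divff.
  rewrite big_ord_recr IH /= [phi (v / 2 ^+ k)]phiE.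
  have -> : v / 2 ^+ k / 2 = v / 2 ^+ k.+1 by rewrite exprS invfM mulrAC mulrA.
  have psi0 : psi (v / 2 ^+ k) != 0.
    by have := phi0 (v / 2 ^+ k); rewrite phiE mulf_eq0 negb_or => /andP[].
  by field; rewrite phi0 psi0.
apply: (@schur_positive_cvg _ _ _ _
    (fun k i j => \prod_(l < k) psi ((s i - s j) / 2 ^+ l))).
  apply: nearW; elim=> [|k IH].
    by apply: eq_schur_positive (schur_positive1 F) => i j; rewrite big_ord0.
  have step : schur_positive c (fun i j => psi ((s i - s j) / 2 ^+ k)).
    apply: eq_schur_positive (P (fun i => s i / 2 ^+ k)) => i j.
    by rewrite mulrBl.
  have sym i j : psi ((s i - s j) / 2 ^+ k) = psi ((s j - s i) / 2 ^+ k).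
    by rewrite -ev -mulNr opprB.
  apply: eq_schur_positive (schur_positiveM F sym step IH) => i j.
  by rewrite big_ord_recr /= mulrC.
move=> i j; under eq_fun do rewrite quot.
set v := s i - s j; suff : (fun k => phi v / phi (v / 2 ^+ k)) @ \oo --> phi v / 1.
  by rewrite divr1.
by apply: cvgM; [exact: cvg_cst|apply: cvgV; rewrite ?oner_neq0].
Qed.

(** [1 / cosh (s i - s j)] is [exp (s i + s j)] times [2 / (exp (2 s i) + exp (2 s j))], a product
    of two positive multipliers. *)
Lemma sech_positive n (c : 'I_n -> V) : jordan_frame c ->
  diff_positive c (fun v => (cosh v)^-1).
Proof.
move=> F s; have u0 i : 0 < expR (2 * s i) by exact: expR_gt0.
have L := lyapunov_inverse_positive F u0.
have sym i j : expR (s i + s j) = expR (s j + s i) by rewrite addrC.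
apply: eq_schur_positive (schur_positiveM F sym (expR_add_positive s F) L) => i j.
have -> : cosh (s i - s j) = (expR (2 * s i) + expR (2 * s j)) / (2 * expR (s i + s j)).
  have -> : expR (2 * s i) = expR (s i - s j) * expR (s i + s j).
    by rewrite -expRD; congr expR; ring.
  have -> : expR (2 * s j) = expR (- (s i - s j)) * expR (s i + s j).
    by rewrite -expRD; congr expR; ring.
  by rewrite /cosh; field; rewrite gt_eqF ?expR_gt0.
by field; rewrite !gt_eqF ?addr_gt0 ?expR_gt0.
Qed.

Lemma inv_sinhc_positive n (c : 'I_n -> V) : jordan_frame c ->
  diff_positive c (fun v => (sinhc v)^-1).
Proof.
(* The factor comes from [sinh v = 2 sinh (v/2) cosh (v/2)]. *)
move=> F; apply: (diff_positive_product (psi := fun v => (cosh (v / 2))^-1)) => //.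
- by move=> v; rewrite mulNr coshN.
- by move=> v; rewrite invr_eq0 gt_eqF ?sinhc_gt0.
- by move=> v; rewrite sinhc_half invfM.
- move=> v; rewrite -[X in _ --> X]invr1.
  by apply: cvgV; [exact: oner_neq0|exact: cvg_sinhc_half_pow].
- move=> s; apply: eq_schur_positive (sech_positive F (fun i => s i / 2)) => i j.
  by rewrite mulrBl.
Qed.

Lemma tanhc_positive n (c : 'I_n -> V) : jordan_frame c ->
  diff_positive c (fun v => sinhc v / cosh v).
Proof.
(* As [2 cosh (v/2)^2 = cosh v + 1], the quotient of the values of [tanh v / v] at [v] and [v/2] is
   [(1 + 1 / cosh v) / 2], a convex combination of positive multipliers. *)
move=> F; apply: (diff_positive_product (psi := fun v => 1 / 2 * 1 + 1 / 2 * (cosh v)^-1)) => //.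
- by move=> v; rewrite coshN.
- by move=> v; rewrite mulf_neq0 ?invr_eq0 ?gt_eqF ?sinhc_gt0 ?cosh_gt0.
- move=> v; rewrite sinhc_half.
  have -> : cosh v = 2 * cosh (v / 2) ^+ 2 - 1 by rewrite cosh_half addrK.
  have := cosh_gt0 v; rewrite -[cosh v](addrK 1) -cosh_half => h.
  by field; rewrite !gt_eqF ?cosh_gt0.
- move=> v; rewrite -[X in _ --> X]divr1.
  apply: cvgM; first exact: cvg_sinhc_half_pow.
  by apply: cvgV; [exact: oner_neq0|exact: cvg_cosh_half_pow].
- move=> s; apply: schur_positive_lin; rewrite ?divr_ge0//.
    exact: schur_positive1.
  exact: sech_positive.
Qed.

End HyperbolicKernels.

(** * The four means of a *)

Section Means.
Context {R : realType} {V : euclideanJordanType R}.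
Implicit Types (x y z u w a b c : V).

(** Integrability is kept with the value because additivity of the integral requires it. *)
Definition has_integral01 (f : R -> R) (l : R) : Prop :=
  lebesgue_measure.-integrable `[0%R, 1%R] (EFin \o f) /\
  (\int[lebesgue_measure]_(t in `[0%R, 1%R]) f t)%R = l.

Lemma has_integral01D f g l m : has_integral01 f l -> has_integral01 g m ->
  has_integral01 (fun t => f t + g t) (l + m).
Proof.
move=> [fi fl] [gi gl]; split; last by rewrite RintegralD// fl gl.
by apply: (@integrableD _ _ _ lebesgue_measure _ _ _ _ fi gi).
Qed.

Lemma has_integral01Z f l k : has_integral01 f l ->
  has_integral01 (fun t => k * f t) (k * l).
Proof.
move=> [fi fl]; split; last by rewrite RintegralZl// fl.
by apply: (@integrableZl _ _ _ lebesgue_measure _ _ k _ fi).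
Qed.

Lemma has_integral01_0 : has_integral01 (fun=> 0) 0.
Proof.
split; first exact: integrable0.
by rewrite Rintegral_cst// mul0r.
Qed.

Lemma has_integral01_sum I (r : seq I) (f : I -> R -> R) (l : I -> R) :
  (forall i, has_integral01 (f i) (l i)) ->
  has_integral01 (fun t => \sum_(i <- r) f i t) (\sum_(i <- r) l i).
Proof.
move=> fl; elim: r => [|i r IH].
  by rewrite big_nil; under eq_fun do rewrite big_nil; exact: has_integral01_0.
rewrite big_cons; under eq_fun do rewrite big_cons.
exact: has_integral01D.
Qed.

Lemma eq_has_integral01 f g l m : (forall t, f t = g t) -> l = m ->
  has_integral01 f l -> has_integral01 g m.
Proof. by move=> fg -> H; have -> : g = f by apply/funext. Qed.

Lemma integrable01_continuous (f : R -> R) : continuous f ->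
  lebesgue_measure.-integrable `[0%R, 1%R] (EFin \o f).
Proof.
move=> cf; apply: continuous_compact_integrable; first exact: segment_compact.
exact: continuous_subspaceT.
Qed.

Lemma has_integral01_expR (al be : R) : al != 0 ->
  has_integral01 (fun t => expR (al * t + be)) ((expR (al + be) - expR be) / al).
Proof.
move=> al0.
have cf : continuous (fun t : R => expR (al * t + be)).
  move=> t; apply: continuous_comp; last exact: continuous_expR.
  by apply: cvgD; [apply: cvgM; [exact: cvg_cst|exact: cvg_id]|exact: cvg_cst].
pose G : R -> R := al^-1 *: (expR \o (fun t : R => al * t + be)).
have dG (t : R) : is_derive t 1 G (expR (al * t + be)).
  have dh : is_derive t 1 (fun t : R => al * t + be) al.
    by apply: is_derive_eq; rewrite ?scaler1 ?scaler0 ?addr0.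
  apply: is_derive_eq.
  by rewrite /GRing.scale /= mulrCA mulVf// mulr1.
split; first exact: integrable01_continuous.
rewrite /Rintegral (continuous_FTC2 (F := G))//.
- by rewrite -EFinB /= /G /GRing.scale /= mulr1 mulr0 add0r -mulrBr mulrC.
- exact: continuous_subspaceT.
- split.
  + by move=> t _; apply: ex_derive.
  + apply: cvg_at_right_filter; apply: differentiable_continuous.
    by apply/derivable1_diffP; apply: ex_derive.
  + apply: cvg_at_left_filter; apply: differentiable_continuous.
    by apply/derivable1_diffP; apply: ex_derive.
- by move=> t _; rewrite derive1E; apply: derive_val.
Qed.

(** The value is the logarithmic mean of [exp (2 p)] and [exp (2 q)]. The case [p = q] is apart
    since the antiderivatives divide by [p - q]. *)
Lemma has_integral01_mean (p q : R) :
  has_integral01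
    (fun t => (expR (2 * p) `^ t * expR (2 * q) `^ (1 - t) +
               expR (2 * q) `^ t * expR (2 * p) `^ (1 - t)) / 2)
    (expR (p + q) * sinhc (p - q)).
Proof.
have powE (r t : R) : expR (2 * r) `^ t = expR (2 * r * t) by rewrite -expRM.
have kE t : 1 / 2 * expR (2 * (p - q) * t + 2 * q) +
     1 / 2 * expR (2 * (q - p) * t + 2 * p) =
    (expR (2 * p) `^ t * expR (2 * q) `^ (1 - t) +
               expR (2 * q) `^ t * expR (2 * p) `^ (1 - t)) / 2.
  rewrite !powE -!expRD.
  have -> : 2 * p * t + 2 * q * (1 - t) = 2 * (p - q) * t + 2 * q by ring.
  have -> : 2 * q * t + 2 * p * (1 - t) = 2 * (q - p) * t + 2 * p by ring.
  by field.
have [pq|pq] := eqVneq p q.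
  have cst : has_integral01 (fun=> expR (q + q)) (expR (q + q)).
    split; first by apply: integrable01_continuous => t; exact: cvg_cst.
    by rewrite Rintegral_cst//= lebesgue_measure_itv/= lte01 EFinN sube0 mulr1.
  apply: eq_has_integral01 cst => [t|]; last by rewrite pq subrr /sinhc eqxx mulr1.
  rewrite pq !powE -!expRD.
  have -> : 2 * q * t + 2 * q * (1 - t) = q + q by ring.
  by field.
have a0 : 2 * (p - q) != 0 by rewrite mulf_neq0 ?pnatr_eq0 ?subr_eq0.
have b0 : 2 * (q - p) != 0 by rewrite mulf_neq0 ?pnatr_eq0 ?subr_eq0 1?eq_sym.
have H := has_integral01D (has_integral01Z (1 / 2) (has_integral01_expR (2 * q) a0))
  (has_integral01Z (1 / 2) (has_integral01_expR (2 * p) b0)).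
apply: eq_has_integral01 H => [t|]; first exact: kE.
rewrite /sinhc subr_eq0 (negPf pq).
have -> : 2 * (p - q) + 2 * q = 2 * p by ring.
have -> : 2 * (q - p) + 2 * p = 2 * q by ring.
have -> : expR (2 * p) = expR (p + q) * expR (p - q) by rewrite -expRD; congr expR; ring.
have -> : expR (2 * q) = expR (p + q) * expR (- (p - q)) by rewrite -expRD; congr expR; ring.
have pq1 : p - q != 0 by rewrite subr_eq0.
have pq2 : q - p != 0 by rewrite subr_eq0 eq_sym.
by field; rewrite pq1 pq2.
Qed.

(** Each coordinate of [schur c m x] is a finite linear combination of the entries of [m], so the
    integral can be taken entrywise. *)
Lemma vintegral01_schur n (c : 'I_n -> V) (k : R -> 'I_n -> 'I_n -> R) l x :
  (forall i j, has_integral01 (fun t => k t i j) (l i j)) ->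
  vintegral01 (fun t => schur c (k t) x) = schur c l x.
Proof.
move=> kl; rewrite [RHS](coord_vbasis (memvf _)); apply: eq_bigr => b _.
have E m : coord (vbasis {:V}) b (schur c m x) =
    \sum_i \sum_j coord (vbasis {:V}) b (peirce c i j x) * m i j.
  rewrite /schur linear_sum; apply: eq_bigr => i _; rewrite linear_sum.
  by apply: eq_bigr => j _; rewrite linearZ /= mulrC.
congr (_ *: _).
suff [] : has_integral01 (fun t => coord (vbasis {:V}) b (schur c (k t) x))
    (coord (vbasis {:V}) b (schur c l x)) by [].
apply: (eq_has_integral01 (fun t => esym (E (k t))) (esym (E l))).
by apply: has_integral01_sum => i; apply: has_integral01_sum => j; apply: has_integral01Z.
Qed.

(** * The operators of the theorem as Schur multipliers *)

Lemma lyapunovE u x : lyapunov u x = u *o x.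
Proof. by rewrite /lyapunov lfunE. Qed.

Lemma jprod2_schur n (c : 'I_n -> V) (s t : 'I_n -> R) x : jordan_frame c ->
  (\sum_k s k *: c k) *o ((\sum_k t k *: c k) *o x) =
  schur c (fun i j => (s i + s j) / 2 * ((t i + t j) / 2)) x.
Proof.
move=> F; rewrite !jprod_schur// schur_comp// => i j.
by rewrite addrC.
Qed.

Lemma quad_rep2_schur n (c : 'I_n -> V) (s t : 'I_n -> R) x : jordan_frame c ->
  quad_rep2 (\sum_k s k *: c k) (\sum_k t k *: c k) x =
  schur c (fun i j => (s i * t j + s j * t i) / 2) x.
Proof.
move=> F; rewrite /quad_rep2 !add_lfunE opp_lfunE !comp_lfunE !lyapunovE.
rewrite !jprod2_schur// [_ ** _](frame_prod s t F) jprod_schur// schurDl schurB.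
by apply: eq_schur => i j; field.
Qed.

Lemma quad_rep_schur n (c : 'I_n -> V) (s : 'I_n -> R) x : jordan_frame c ->
  quad_rep (\sum_k s k *: c k) x = schur c (fun i j => s i * s j) x.
Proof.
move=> F; rewrite /quad_rep -[_ ** (_ ** _)]/(_ *o (_ *o _)) jprod2_schur//.
rewrite -[_ ** _ ** _]/(_ *o _ *o _) frame_prod// jprod_schur// schurZl schurB.
by apply: eq_schur => i j; field.
Qed.

Lemma lyapunov_inv_schur n (c : 'I_n -> V) (s : 'I_n -> R) x : jordan_frame c ->
  (forall i, 0 < s i) ->
  (lyapunov (\sum_k s k *: c k))^-1%VF x = schur c (fun i j => 2 / (s i + s j)) x.
Proof.
move=> F s0; set b := \sum_k _.
have sij i j : s i + s j != 0 by rewrite gt_eqF ?addr_gt0.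
have inv y : schur c (fun i j => 2 / (s i + s j)) (b *o y) = y.
  rewrite jprod_schur// schur_comp//; last by move=> i j; rewrite addrC.
  by rewrite -[RHS](schur1 y F); apply: eq_schur => i j; field.
(* A left inverse gives injectivity, and an injective endomorphism in finite dimension is
   invertible. *)
have ker : lker (lyapunov b) == 0%VS.
  apply/lker0P => y z; rewrite !lyapunovE => e.
  by rewrite -(inv y) e inv.
by rewrite -[in RHS](lker0_lfunVK ker x) lyapunovE inv.
Qed.

End Means.

Theorem mainTheorem3 (R : realType) (V : euclideanJordanType R)
    (trace_inner_product : forall x y : V, jdot x y = jtr (x ** y))
    (a : V) (a_gt0 : jpos a) (x : V) :
  [/\ (lyapunov (jinv a))^-1%VF x \prec quad_rep (jsqrt a) x,
      quad_rep (jsqrt a) x \prec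
        vintegral01 (fun t : R => quad_rep2 (jpow a t) (jpow a (1 - t)) x) &
      vintegral01 (fun t : R => quad_rep2 (jpow a t) (jpow a (1 - t)) x) \prec
        lyapunov a x].
Proof.
have [_ [c sa]] := lambdaP a; have F := proj1 sa.
pose al (i : 'I_(size (lambda a))) := (lambda a)`_i.
have al0 i : 0 < al i by apply: a_gt0; exact: mem_nth.
(* Half the logarithm, so that the geometric mean of [al i] and [al j] is [exp (s i + s j)]. *)
pose s i := ln (al i) / 2.
have alE i : al i = expR (2 * s i) by rewrite /s mulrCA mulfV ?pnatr_eq0// mulr1 lnK ?posrE.
have harmE : (lyapunov (jinv a))^-1%VF x =
    schur c (fun i j => expR (s i + s j) / cosh (s i - s j)) x.
  rewrite /jinv (spectral_jfun _ sa) lyapunov_inv_schur//; last first.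
    by move=> i; rewrite invr_gt0; exact: al0.
  apply: eq_schur => i j; rewrite -/(al i) -/(al j) !alE.
  have -> : expR (2 * s i) = expR (s i + s j) * expR (s i - s j).
    by rewrite -expRD; congr expR; ring.
  have -> : expR (2 * s j) = expR (s i + s j) * expR (- (s i - s j)).
    by rewrite -expRD; congr expR; ring.
  rewrite /cosh expRN.
  by field; rewrite !gt_eqF ?addr_gt0 ?mulr_gt0 ?expR_gt0.
have geomE : quad_rep (jsqrt a) x = schur c (fun i j => expR (s i + s j)) x.
  rewrite /jsqrt /jpow (spectral_jfun _ sa) quad_rep_schur//; apply: eq_schur => i j.
  rewrite -/(al i) -/(al j) !alE -!expRM -expRD. by congr expR; field.
have logE : vintegral01 (fun t : R => quad_rep2 (jpow a t) (jpow a (1 - t)) x) =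
    schur c (fun i j => expR (s i + s j) * sinhc (s i - s j)) x.
  pose k t i j := (al i `^ t * al j `^ (1 - t) + al j `^ t * al i `^ (1 - t)) / 2.
  rewrite -(@vintegral01_schur _ _ _ c k); last first.
    by move=> i j; rewrite /k !alE; exact: has_integral01_mean.
  congr vintegral01; apply/funext => t.
  rewrite /jpow !(spectral_jfun _ sa) quad_rep2_schur//.
have arithE : lyapunov a x = schur c (fun i j => expR (s i + s j) * cosh (s i - s j)) x.
  rewrite lyapunovE [in LHS](proj2 sa) jprod_schur//; apply: eq_schur => i j.
  rewrite -/(al i) -/(al j) !alE /cosh mulrA mulrDr -!expRD.
  by congr ((expR _ + expR _) / 2); ring.
have coshS i j : cosh (s i - s j) = cosh (s j - s i) by apply: even_diff; exact: coshN.
have sinhcS i j : sinhc (s i - s j) = sinhc (s j - s i) by apply: even_diff; exact: sinhcN.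
(* The values at 0 give the three multipliers their unit diagonal. *)
have cosh0 : cosh 0 = 1 :> R by rewrite /cosh oppr0 expR0; field.
have sinhc0 : sinhc 0 = 1 :> R by rewrite /sinhc eqxx.
rewrite harmE geomE logE arithE; split.
- rewrite (_ : schur c _ x = schur c (fun i j => (cosh (s i - s j))^-1)
      (schur c (fun i j => expR (s i + s j)) x)).
    apply: schur_majorized => //; last exact: (sech_positive F s).
    - by move=> i j; rewrite coshS.
    - by move=> i; rewrite subrr cosh0 invr1.
  rewrite schur_comp//; last by move=> i j; rewrite coshS.
  by apply: eq_schur => i j; rewrite mulrC.
- rewrite (_ : schur c (fun i j => expR (s i + s j)) x =
      schur c (fun i j => (sinhc (s i - s j))^-1)
      (schur c (fun i j => expR (s i + s j) * sinhc (s i - s j)) x)).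
    apply: schur_majorized => //; last exact: (inv_sinhc_positive F s).
    - by move=> i j; rewrite sinhcS.
    - by move=> i; rewrite subrr sinhc0 invr1.
  rewrite schur_comp//; last by move=> i j; rewrite sinhcS.
  by apply: eq_schur => i j; rewrite mulrC mulfK// gt_eqF ?sinhc_gt0.
- rewrite (_ : schur c (fun i j => expR (s i + s j) * sinhc (s i - s j)) x =
      schur c (fun i j => sinhc (s i - s j) / cosh (s i - s j))
      (schur c (fun i j => expR (s i + s j) * cosh (s i - s j)) x)).
    apply: schur_majorized => //; last exact: (tanhc_positive F s).
    - by move=> i j; rewrite sinhcS coshS.
    - by move=> i; rewrite subrr sinhc0 cosh0 divr1.
  rewrite schur_comp//; last by move=> i j; rewrite sinhcS coshS.
  by apply: eq_schur => i j; field; rewrite gt_eqF ?cosh_gt0.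
Qed.
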